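(* Consider problem $\min_{\mathbf x\in\mathbb R^n}F(\mathbf x)=\sum_{i=1}^I f_i(\mathbf x)$ where each $f_i$ is $L_i$-Lipschitz differentiable and $F$ is $\tau$-strongly convex, and let $\mathbf x^\star$ be its unique minimizer. Let $\{(\mathbf x_i^k)_{i=1}^I\}_k$ be generated by ASY-SONATA (as described in the context) with constant step-size $\gamma^k\equiv\gamma$. Then there exists a constant $\bar\gamma_1>0$ such that for every $\gamma\in(0,\bar\gamma_1)$ there is $\lambda\in(0,1)$ with $\|\mathbf x^k-\mathbf 1_I\otimes\mathbf x^\star\|=\mathcal O(\lambda^k)$, where $\mathbf x^k=[\mathbf x_1^{k\top},\dots,\mathbf x_I^{k\top}]^\top$. Moreover, there is a constant $\hat\gamma_1\in(0,\bar\gamma_1)$ such that for $\gamma\in(0,\hat\gamma_1]$ one may take $\lambda=1-\tau\eta^2\gamma/2$ with $\eta=\bar m^{K_1}$, $K_1=(2I-1)T+ID$.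
   Context: Graph: $\mathcal G=(\mathcal V,\mathcal E)$, $\mathcal V=\{1,\dots,I\}$, strongly connected digraph without self-loops; $\mathcal N_i^{\rm in}=\{j:(j,i)\in\mathcal E\}$, $\mathcal N_i^{\rm out}=\{j:(i,j)\in\mathcal E\}$. Weight matrices $W=(w_{ij})$ (row-stochastic) and $A=(a_{ij})$ (column-stochastic) satisfy, for some $\bar m\in(0,1)$: diagonal entries $\ge\bar m$, entries $(i,j)$ with $(j,i)\in\mathcal E$ are $\ge\bar m$, all other entries $0$. Asynchrony model: $(i^k,\mathbf d^k)_{k\in\mathbb N_0}$, $i^k\in\mathcal V$, $\mathbf d^k=(d_j^k)_{j\in\mathcal N^{\rm in}_{i^k}}$, with every agent appearing among $i^k,\dots,i^{k+T-1}$ for all $k$ and $0\le d_j^k\le D$. ASY-SONATA: initialization $\mathbf x_i^0\in\mathbb R^n$, $\mathbf z_i^0=\nabla f_i(\mathbf x_i^0)$, $\tilde{\boldsymbol\rho}_{ij}^0=0$, $\tau_{ij}^{-1}=-D$, and $\boldsymbol\rho_{ij}^t=0$, $\mathbf v_i^t=0$ for $t=-D,\dots,0$. At iteration $k$ with $i=i^k$: (1) $\tau_{ij}^k=\max(\tau_{ij}^{k-1},k-d_j^k)$, $j\in\mathcal N_i^{\rm in}$; (2) $\mathbf v_i^{k+1}=\mathbf x_i^k-\gamma^k\mathbf z_i^k$; (3) $\mathbf x_i^{k+1}=w_{ii}\mathbf v_i^{k+1}+\sum_{j\in\mathcal N_i^{\rm in}}w_{ij}\mathbf v_j^{\tau_{ij}^k}$;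 (4) $\mathbf z_i^{k+1/2}=\mathbf z_i^k+\sum_{j\in\mathcal N_i^{\rm in}}(\boldsymbol\rho_{ij}^{\tau_{ij}^k}-\tilde{\boldsymbol\rho}_{ij}^k)+\nabla f_i(\mathbf x_i^{k+1})-\nabla f_i(\mathbf x_i^k)$; (5) $\mathbf z_i^{k+1}=a_{ii}\mathbf z_i^{k+1/2}$ and $\boldsymbol\rho_{ji}^{k+1}=\boldsymbol\rho_{ji}^k+a_{ji}\mathbf z_i^{k+1/2}$ for $j\in\mathcal N_i^{\rm out}$; (6) $\tilde{\boldsymbol\rho}_{ij}^{k+1}=\boldsymbol\rho_{ij}^{\tau_{ij}^k}$ for $j\in\mathcal N_i^{\rm in}$; (7) all other variables keep their values. *)

(* Defs.v *)
From Stdlib Require Import Reals ZArith.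
From mathcomp Require Import all_boot.
Set Implicit Arguments. Unset Strict Implicit. Unset Printing Implicit Defensive.

Open Scope R_scope.

Definition vec (n : nat) := 'I_n -> R.

Definition vzero n : vec n := fun _ => R0.
Definition vadd n (u w : vec n) : vec n := fun c => u c + w c.
Definition vsub n (u w : vec n) : vec n := fun c => u c - w c.
Definition vscale n (a : R) (u : vec n) : vec n := fun c => a * u c.
Definition dot n (u w : vec n) : R := \big[Rplus/R0]_(c < n) (u c * w c).
Definition vnorm n (u : vec n) : R := sqrt (dot u u).

Definition vsum n I (P : pred 'I_I) (F : 'I_I -> vec n) : vec n :=
  fun c => \big[Rplus/R0]_(j < I | P j) F j c.

Definition sumf n I (f : 'I_I -> vec n -> R) (y : vec n) : R :=
  \big[Rplus/R0]_(i < I) f i y.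

Definition has_gradient n (f : vec n -> R) (g : vec n -> vec n) : Prop :=
  forall x eps, 0 < eps -> exists delta, 0 < delta /\
    forall h, vnorm h < delta ->
      Rabs (f (vadd x h) - f x - dot (g x) h) <= eps * vnorm h.

Definition lipschitz n (g : vec n -> vec n) (L : R) : Prop :=
  forall x y, vnorm (vsub (g x) (g y)) <= L * vnorm (vsub x y).

Definition strongly_convex n (F : vec n -> R) (tau : R) : Prop :=
  0 < tau /\
  forall x y t, 0 <= t <= 1 ->
    F (vadd (vscale t x) (vscale (1 - t) y)) <=
      t * F x + (1 - t) * F y - tau / 2 * t * (1 - t) * (vnorm (vsub x y))^2.

Definition strongly_connected_noloop I (E : rel 'I_I) : Prop :=
  (forall i j, connect E i j) /\ (forall i, ~~ E i i).

Definition weight_pattern I (E : rel 'I_I) (M : 'I_I -> 'I_I -> R) (mbar : R) : Prop :=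
  (forall i, mbar <= M i i) /\
  (forall i j, E j i -> mbar <= M i j) /\
  (forall i j, i != j -> ~~ E j i -> M i j = 0).

Definition row_stochastic I (M : 'I_I -> 'I_I -> R) : Prop :=
  forall i, \big[Rplus/R0]_(j < I) M i j = 1.

Definition col_stochastic I (M : 'I_I -> 'I_I -> R) : Prop :=
  forall j, \big[Rplus/R0]_(i < I) M i j = 1.

Definition admissible_asynchrony I (E : rel 'I_I) (T D : nat)
    (ik : nat -> 'I_I) (d : nat -> 'I_I -> nat) : Prop :=
  (forall k (a : 'I_I), exists t, (k <= t)%nat /\ (t < k + T)%nat /\ ik t = a) /\
  (forall k j, E j (ik k) -> (d k j <= D)%nat).

(* ASY-SONATA trajectory (relational specification; the recursion determines
   all variables uniquely on the times that are used).
   x k i = x_i^k, z k i = z_i^k, v t i = v_i^t (t : Z, t >= -D),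
   rho t i j = rho_{ij}^t, rt k i j = tilde rho_{ij}^k,
   tv k i j = tau_{ij}^k (k : Z, k >= -1). *)
Definition asy_sonata n I (E : rel 'I_I) (W A : 'I_I -> 'I_I -> R)
    (grad : 'I_I -> vec n -> vec n) (gamma : nat -> R) (D : nat)
    (ik : nat -> 'I_I) (d : nat -> 'I_I -> nat)
    (x z : nat -> 'I_I -> vec n) (v : Z -> 'I_I -> vec n)
    (rho : Z -> 'I_I -> 'I_I -> vec n) (rt : nat -> 'I_I -> 'I_I -> vec n)
    (tv : Z -> 'I_I -> 'I_I -> Z) : Prop :=
  (forall i, z 0%nat i = grad i (x 0%nat i)) /\
  (forall i j, rt 0%nat i j = @vzero n) /\
  (forall i j, tv (-1)%Z i j = (- Z.of_nat D)%Z) /\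
  (forall t i j, (- Z.of_nat D <= t <= 0)%Z -> rho t i j = @vzero n) /\
  (forall t i, (- Z.of_nat D <= t <= 0)%Z -> v t i = @vzero n) /\
  (forall k : nat,
    let i := ik k in
    let K := Z.of_nat k in
    (forall j, E j i -> tv K i j = Z.max (tv (K - 1)%Z i j) (K - Z.of_nat (d k j))%Z) /\
    (forall a j, ~ (a = i /\ E j i) -> tv K a j = tv (K - 1)%Z a j) /\
    v (K + 1)%Z i = vsub (x k i) (vscale (gamma k) (z k i)) /\
    (forall a, a <> i -> v (K + 1)%Z a = v K a) /\
    x (S k) i = vadd (vscale (W i i) (v (K + 1)%Z i))
                     (vsum (fun j => E j i) (fun j => vscale (W i j) (v (tv K i j) j))) /\
    (forall a, a <> i -> x (S k) a = x k a) /\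
    (let zh := vadd (vadd (z k i)
                          (vsum (fun j => E j i)
                                (fun j => vsub (rho (tv K i j) i j) (rt k i j))))
                    (vsub (grad i (x (S k) i)) (grad i (x k i))) in
     z (S k) i = vscale (A i i) zh /\
     (forall j, E i j -> rho (K + 1)%Z j i = vadd (rho K j i) (vscale (A j i) zh))) /\
    (forall a, a <> i -> z (S k) a = z k a) /\
    (forall a b, ~ (b = i /\ E i a) -> rho (K + 1)%Z a b = rho K a b) /\
    (forall j, E j i -> rt (S k) i j = rho (tv K i j) i j) /\
    (forall a j, ~ (a = i /\ E j i) -> rt (S k) a j = rt k a j)).

Definition stacked_err n I (xk : 'I_I -> vec n) (xs : vec n) : R :=
  sqrt (\big[Rplus/R0]_(i < I) dot (vsub (xk i) xs) (vsub (xk i) xs)).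

(* Main.v *)
Require Import Defs.
From Stdlib Require Import Reals ZArith Lra Lia FunctionalExtensionality.
From HB Require Import structures.
From mathcomp Require Import all_boot zify.
Set Implicit Arguments. Unset Strict Implicit. Unset Printing Implicit Defensive.
Open Scope R_scope.

(* Adding nodes for the delayed copies of v and for the mass in transit on the edges turns
   both halves of the algorithm into driven linear systems H(k+1) = Q_k (H(k) + u_k e_{a_k}):
   row-stochastic averaging for (x, v), mass-preserving pushing for (z, rho).  Every window of
   K_1 = (2I-1)T + ID steps connects all nodes with weight at least eta = mbar^K_1, so in each
   window averaging shrinks the radius of the states, and pushing shrinks the deviation of z_i
   from xi_i times the total gradient, by the factor 1 - eta, up to the disturbances.

   Weighting the states by the rows of the averaging product up to a finite horizon gives a
   point that moves by -gamma psi z_i with psi >= eta, hence by an approximate gradient step of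
   length gamma psi xi >= gamma eta^2, which contracts by 1 - (3/4) tau eta^2 gamma.  The three
   errors decay together like lam^k: the consensus error is driven by gamma times the others,
   the tracking error by the consensus error and gamma, and both enter the optimality error
   with a factor gamma. *)

(** * Finite real sums and the Euclidean norm *)

Fact RplusA : associative Rplus.
Proof. by move=> a b c; rewrite Rplus_assoc. Qed.
HB.instance Definition _ :=
  Monoid.isComLaw.Build R R0 Rplus RplusA Rplus_comm Rplus_0_l.

Section RealSums.
Variables (J : Type) (r : seq J) (P : pred J).
Implicit Types F G : J -> R.

Lemma Rsum_ge0 F : (forall j, P j -> 0 <= F j) -> 0 <= \big[Rplus/R0]_(j <- r | P j) F j.
Proof. by move=> H; apply: big_ind => //; [lra | move=> *; lra]. Qed.

Lemma Rsum_le F G : (forall j, P j -> F j <= G j) ->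
  \big[Rplus/R0]_(j <- r | P j) F j <= \big[Rplus/R0]_(j <- r | P j) G j.
Proof. by move=> H; apply: (big_ind2 Rle) => //; [lra | move=> *; lra]. Qed.

Lemma Rsum_mull a F :
  a * \big[Rplus/R0]_(j <- r | P j) F j = \big[Rplus/R0]_(j <- r | P j) (a * F j).
Proof. by apply: (big_morph (Rmult a)) => [x y|]; ring. Qed.

Lemma Rsum_mulr a F :
  (\big[Rplus/R0]_(j <- r | P j) F j) * a = \big[Rplus/R0]_(j <- r | P j) (F j * a).
Proof. by apply: (big_morph (fun x => x * a)) => [x y|]; ring. Qed.

Lemma Rsum_add F G : \big[Rplus/R0]_(j <- r | P j) (F j + G j) =
  \big[Rplus/R0]_(j <- r | P j) F j + \big[Rplus/R0]_(j <- r | P j) G j.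
Proof. exact: big_split. Qed.

Lemma Rsum_sub F G : \big[Rplus/R0]_(j <- r | P j) (F j - G j) =
  \big[Rplus/R0]_(j <- r | P j) F j - \big[Rplus/R0]_(j <- r | P j) G j.
Proof.
rewrite [in RHS]/Rminus; have -> x : - x = -1 * x by ring.
by rewrite Rsum_mull -Rsum_add; apply: eq_bigr => j _; ring.
Qed.

End RealSums.

Lemma Rsum_mem_le (J : finType) (F : J -> R) i :
  (forall j, 0 <= F j) -> F i <= \big[Rplus/R0]_j F j.
Proof.
move=> F0; rewrite (bigD1 i) //=.
have := Rsum_ge0 (index_enum J) (P := fun j => j != i) (fun j _ => F0 j).
by move=> H; lra.
Qed.

Lemma Rsum_delta (J : finType) (i : J) (F : J -> R) :
  \big[Rplus/R0]_j (if j == i then F j else 0) = F i.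
Proof. by rewrite -big_mkcond big_pred1_eq. Qed.

Lemma Rsum_const (J : finType) (a : R) : \big[Rplus/R0]_(j : J) a = INR #|J| * a.
Proof.
rewrite big_const; elim: #|J| => [|m IH]; first by rewrite /=; ring.
by rewrite iterS IH S_INR; ring.
Qed.

Lemma Rsum_ord_le (m : nat) (F : nat -> R) (a : R) :
  (forall l, (l < m)%N -> F l <= a) -> \big[Rplus/R0]_(l < m) F l <= INR m * a.
Proof.
move=> h; rewrite -[X in INR X](card_ord m) -Rsum_const.
by apply: Rsum_le => l _; apply: h.
Qed.

Section Vectors.
Variable n : nat.
Implicit Types u w x y : vec n.

Lemma dot_sym u w : dot u w = dot w u.
Proof. by apply: eq_bigr => c _; ring. Qed.

Lemma dot_addl u x w : dot (vadd u x) w = dot u w + dot x w.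
Proof. by rewrite /dot -Rsum_add; apply: eq_bigr => c _; rewrite /vadd; ring. Qed.

Lemma dot_scalel a u w : dot (vscale a u) w = a * dot u w.
Proof. by rewrite /dot Rsum_mull; apply: eq_bigr => c _; rewrite /vscale; ring. Qed.

Lemma dot_scaler a u w : dot u (vscale a w) = a * dot u w.
Proof. by rewrite dot_sym dot_scalel dot_sym. Qed.

Lemma dot_subl u x w : dot (vsub u x) w = dot u w - dot x w.
Proof. by rewrite /dot -Rsum_sub; apply: eq_bigr => c _; rewrite /vsub; ring. Qed.

Lemma dot_subr u x w : dot w (vsub u x) = dot w u - dot w x.
Proof. by rewrite dot_sym dot_subl !(dot_sym w). Qed.

Lemma dot_ge0 u : 0 <= dot u u.
Proof. by apply: Rsum_ge0 => c _; nra. Qed.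

Lemma vnorm_ge0 u : 0 <= vnorm u.
Proof. exact: sqrt_pos. Qed.

Lemma vnorm_sqr u : vnorm u ^ 2 = dot u u.
Proof. by rewrite /vnorm /= Rmult_1_r sqrt_sqrt //; exact: dot_ge0. Qed.

Lemma vnorm_le u a : 0 <= a -> dot u u <= a ^ 2 -> vnorm u <= a.
Proof.
by move=> a0 h; rewrite -(sqrt_pow2 _ a0); apply: sqrt_le_1_alt.
Qed.

Lemma vnorm_eq0 u : vnorm u = 0 -> u = @vzero n.
Proof.
move=> u0; apply: functional_extensionality => c.
have := vnorm_sqr u; rewrite u0 => /esym e.
have: u c * u c <= dot u u.
  by apply: (Rsum_mem_le (F := fun c => u c * u c)) => d; nra.
by rewrite e /vzero => h; nra.
Qed.

Lemma dot_vzero u : dot (@vzero n) u = 0.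
Proof. by rewrite /dot big1 // => c _; rewrite /vzero; ring. Qed.

(** Cauchy-Schwarz, by expanding the square of [vnorm w] u - [vnorm u] w; when a norm vanishes, its
    vector is zero. *)
Lemma dot_le u w : dot u w <= vnorm u * vnorm w.
Proof.
have u0 := vnorm_ge0 u; have w0 := vnorm_ge0 w.
have su := vnorm_sqr u; have sw := vnorm_sqr w.
have := dot_ge0 (vsub (vscale (vnorm w) u) (vscale (vnorm u) w)).
rewrite !(dot_subl, dot_subr, dot_scalel, dot_scaler) (dot_sym w u) -su -sw => H.
have [p0|p0] : 0 < vnorm u * vnorm w \/ vnorm u * vnorm w <= 0 by lra.
  apply: (Rmult_le_reg_l (2 * (vnorm u * vnorm w))); first lra.
  by nra.
have [e|e] : vnorm u = 0 \/ vnorm w = 0 by apply: Rmult_integral; nra.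
  by rewrite e (vnorm_eq0 e) dot_vzero; lra.
by rewrite e dot_sym (vnorm_eq0 e) dot_vzero; lra.
Qed.

Lemma vnorm_add u w : vnorm (vadd u w) <= vnorm u + vnorm w.
Proof.
have u0 := vnorm_ge0 u; have w0 := vnorm_ge0 w.
apply: vnorm_le; first lra.
rewrite dot_addl !(dot_sym _ (vadd _ _)) !dot_addl (dot_sym w u).
have := dot_le u w; have := vnorm_sqr u; have := vnorm_sqr w; nra.
Qed.

Lemma vnorm_scale a u : vnorm (vscale a u) = Rabs a * vnorm u.
Proof.
rewrite /vnorm dot_scalel dot_scaler -Rmult_assoc sqrt_mult_alt; last nra.
by rewrite -/(Rsqr a) sqrt_Rsqr_abs.
Qed.

Lemma vnorm_scale_ge0 a u : 0 <= a -> vnorm (vscale a u) = a * vnorm u.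
Proof. by move=> a0; rewrite vnorm_scale Rabs_pos_eq. Qed.

Lemma vnorm_vzero : vnorm (@vzero n) = 0.
Proof. by rewrite /vnorm /dot big1 ?sqrt_0 // => c _; rewrite /vzero; ring. Qed.

Lemma vsubxx u : vsub u u = @vzero n.
Proof. by apply: functional_extensionality => c; rewrite /vsub /vzero; ring. Qed.

Lemma vnorm_opp u : vnorm (vscale (-1) u) = vnorm u.
Proof. by rewrite vnorm_scale Rabs_Ropp Rabs_R1 Rmult_1_l. Qed.

Lemma vnorm_sub_sym u w : vnorm (vsub u w) = vnorm (vsub w u).
Proof.
rewrite -(vnorm_opp (vsub u w)); congr vnorm.
by apply: functional_extensionality => c; rewrite /vsub /vscale; ring.
Qed.

Lemma vnorm_sub_triangle y u w :
  vnorm (vsub u w) <= vnorm (vsub u y) + vnorm (vsub y w).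
Proof.
have -> : vsub u w = vadd (vsub u y) (vsub y w).
  by apply: functional_extensionality => c; rewrite /vsub /vadd; ring.
exact: vnorm_add.
Qed.

Lemma vnorm_sub u w : vnorm (vsub u w) <= vnorm u + vnorm w.
Proof.
have -> : vsub u w = vadd u (vscale (-1) w).
  by apply: functional_extensionality => c; rewrite /vsub /vadd /vscale; ring.
by rewrite -(vnorm_opp w); exact: vnorm_add.
Qed.

Definition vcomb (J : finType) (p : J -> R) (h : J -> vec n) : vec n :=
  fun c => \big[Rplus/R0]_j (p j * h j c).

Lemma vnorm_sum (J : Type) (r : seq J) (h : J -> vec n) :
  vnorm (fun c => \big[Rplus/R0]_(j <- r) h j c) <= \big[Rplus/R0]_(j <- r) vnorm (h j).
Proof.
elim: r => [|j r IH].
  rewrite big_nil; have -> : (fun c => \big[Rplus/R0]_(j <- [::]) h j c) = @vzero n.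
    by apply: functional_extensionality => c; rewrite big_nil.
  by rewrite vnorm_vzero; lra.
rewrite big_cons.
have -> : (fun c => \big[Rplus/R0]_(i <- j :: r) h i c) =
          vadd (h j) (fun c => \big[Rplus/R0]_(i <- r) h i c).
  by apply: functional_extensionality => c; rewrite big_cons.
have := vnorm_add (h j) (fun c => \big[Rplus/R0]_(i <- r) h i c); lra.
Qed.

Lemma vnorm_vcomb (J : finType) (p : J -> R) (h : J -> vec n) :
  (forall j, 0 <= p j) ->
  vnorm (vcomb p h) <= \big[Rplus/R0]_j (p j * vnorm (h j)).
Proof.
move=> p0; apply: Rle_trans (vnorm_sum (index_enum J) (fun j => vscale (p j) (h j))) _.
by apply: Rsum_le => j _; rewrite vnorm_scale_ge0 //; lra.
Qed.

Lemma vnorm_vcomb_le (J : finType) (p : J -> R) (h : J -> vec n) (X : R) :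
  (forall j, 0 <= p j) -> (forall j, vnorm (h j) <= X) ->
  vnorm (vcomb p h) <= \big[Rplus/R0]_j p j * X.
Proof.
move=> p0 hX; apply: Rle_trans (vnorm_vcomb h p0) _.
rewrite Rsum_mulr; apply: Rsum_le => j _; have := p0 j; have := hX j; nra.
Qed.

Lemma vcomb_subr (J : finType) (p : J -> R) (h : J -> vec n) x :
  \big[Rplus/R0]_j p j = 1 ->
  vsub (vcomb p h) x = vcomb p (fun j => vsub (h j) x).
Proof.
move=> p1; apply: functional_extensionality => c; rewrite /vcomb /vsub.
transitivity (\big[Rplus/R0]_j (p j * h j c) - \big[Rplus/R0]_j (p j * x c)).
  by rewrite -Rsum_mulr p1; ring.
by rewrite -Rsum_sub; apply: eq_bigr => j _; ring.
Qed.

Lemma vnorm_vcomb_sub_le (J : finType) (p : J -> R) (h : J -> vec n) x X :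
  (forall j, 0 <= p j) -> \big[Rplus/R0]_j p j = 1 ->
  (forall j, vnorm (vsub (h j) x) <= X) -> vnorm (vsub (vcomb p h) x) <= X.
Proof.
move=> p0 p1 hX; rewrite vcomb_subr //.
by have := vnorm_vcomb_le p0 hX; rewrite p1; lra.
Qed.

End Vectors.

(** * Products of stochastic matrices *)

Section Transfer.
Variables (S : finType) (Q : nat -> S -> S -> R).

(* The product Q_k Q_(k+1) ... Q_(k+m-1): the total weight of the paths that
   leave s at time k and arrive in t at time k + m. *)
Fixpoint transfer (k m : nat) (s t : S) {struct m} : R :=
  if m is m'.+1 then \big[Rplus/R0]_r (Q k s r * transfer k.+1 m' r t)
  else if s == t then 1 else 0.

Lemma transfer_add k m m' s t : transfer k (m + m') s t =
  \big[Rplus/R0]_r (transfer k m s r * transfer (k + m) m' r t).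
Proof.
elim: m k s => [|m IH] k s.
  rewrite add0n addn0 /= -(Rsum_delta s (fun r => transfer k m' r t)).
  by apply: eq_bigr => r _; rewrite eq_sym; case: eqP => _; ring.
rewrite addSn /=.
under eq_bigr => r _ do rewrite IH Rsum_mull.
rewrite exchange_big; apply: eq_bigr => r _.
rewrite Rsum_mulr; apply: eq_bigr => q _.
by rewrite addSnnS; ring.
Qed.

Lemma transfer_Sr k m s t : transfer k m.+1 s t =
  \big[Rplus/R0]_r (transfer k m s r * Q (k + m) r t).
Proof.
rewrite -addn1 transfer_add; apply: eq_bigr => r _; congr (_ * _).
rewrite /= -(Rsum_delta t (fun q => Q (k + m) r q)).
by apply: eq_bigr => q _; case: eqP => _; ring.
Qed.

(** Timed paths: each step uses up one matrix and carries weight at least [mbar], so lower bounds on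
    products become a question of reachability. *)
Inductive reach (mbar : R) : nat -> S -> nat -> S -> Prop :=
| reach_refl k s : reach mbar k s k s
| reach_step k s k' t t' :
    reach mbar k s k' t -> mbar <= Q k' t t' -> reach mbar k s k'.+1 t'.

Lemma reach_trans mbar k s k' t k'' r :
  reach mbar k s k' t -> reach mbar k' t k'' r -> reach mbar k s k'' r.
Proof.
move=> h h'; elim: h' h => [//|k1 s1 k2 t1 t2 _ IH hQ h].
exact: reach_step (IH h) hQ.
Qed.

Lemma reach_le mbar k s k' t : reach mbar k s k' t -> (k <= k')%N.
Proof. by elim=> [//|*]; apply: leq_trans (leqnSn _). Qed.

Hypothesis Q0 : forall k s t, 0 <= Q k s t.

Lemma transfer_ge0 k m s t : 0 <= transfer k m s t.
Proof.
elim: m k s => [|m IH] k s /=; first by case: eqP => _; lra.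
by apply: Rsum_ge0 => r _; apply: Rmult_le_pos.
Qed.

(** One path already contributes the product of its weights; all others contribute nonnegatively. *)
Lemma reach_transfer mbar k s k' t : 0 <= mbar -> reach mbar k s k' t ->
  mbar ^ (k' - k) <= transfer k (k' - k) s t.
Proof.
move=> m0; elim=> [k1 s1|k1 s1 k2 t1 t2 h IH hQ].
  by rewrite subnn /= eqxx; lra.
rewrite subSn ?(reach_le h) // transfer_Sr subnKC ?(reach_le h) //.
apply: Rle_trans (Rsum_mem_le (F := fun r => transfer k1 (k2 - k1) s1 r * Q k2 r t2) t1 _).
  have := pow_le mbar (k2 - k1) m0 => m1.
  by rewrite /= Rmult_comm; apply: Rmult_le_compat.
by move=> r; apply: Rmult_le_pos => //; apply: transfer_ge0.
Qed.

Section ColStochastic.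
Hypothesis Q1 : forall k t, \big[Rplus/R0]_s Q k s t = 1.

Lemma transfer_col1 k m t : \big[Rplus/R0]_s transfer k m s t = 1.
Proof.
elim: m k => [|m IH] k /=.
  exact: (Rsum_delta t (fun _ => 1)).
rewrite exchange_big -[RHS](IH k.+1); apply: eq_bigr => r _.
by rewrite -Rsum_mulr Q1; ring.
Qed.

Lemma transfer_col_le1 k m s t : transfer k m s t <= 1.
Proof.
rewrite -(transfer_col1 k m t); apply: (Rsum_mem_le (F := fun s => transfer k m s t)).
by move=> r; apply: transfer_ge0.
Qed.

(** The first K steps give the bound, and the columns of the remaining product average it. *)
Lemma transfer_col_lb K eta s : (forall k t, eta <= transfer k K s t) ->
  forall k m t, (K <= m)%N -> eta <= transfer k m s t.
Proof.
move=> h k m t Km; rewrite -(subnKC Km) transfer_add.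
rewrite -[X in X <= _]Rmult_1_r -(transfer_col1 (k + K) (m - K) t) Rsum_mull.
by apply: Rsum_le => r _; apply: Rmult_le_compat_r; first exact: transfer_ge0.
Qed.
End ColStochastic.

Section RowStochastic.
Hypothesis Q1 : forall k s, \big[Rplus/R0]_t Q k s t = 1.

Lemma transfer_row1 k m s : \big[Rplus/R0]_t transfer k m s t = 1.
Proof.
elim: m k s => [|m IH] k s /=.
  by rewrite -[RHS](Rsum_delta s (fun _ => 1)); apply: eq_bigr => t _; rewrite eq_sym.
rewrite exchange_big -[RHS](Q1 k s); apply: eq_bigr => r _.
by rewrite -Rsum_mull IH; ring.
Qed.

Lemma transfer_row_le1 k m s t : transfer k m s t <= 1.
Proof.
rewrite -(transfer_row1 k m s); apply: (Rsum_mem_le (F := fun t => transfer k m s t)).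
by move=> r; apply: transfer_ge0.
Qed.

(** Here the last K steps give the bound, and the rows of the earlier product average it. *)
Lemma transfer_row_lb K eta t : (forall k s, eta <= transfer k K s t) ->
  forall k m s, (K <= m)%N -> eta <= transfer k m s t.
Proof.
move=> h k m s Km; rewrite -(subnK Km) transfer_add.
rewrite -[X in X <= _]Rmult_1_l -(transfer_row1 k (m - K) s) Rsum_mulr.
by apply: Rsum_le => r _; apply: Rmult_le_compat_l; first exact: transfer_ge0.
Qed.
End RowStochastic.

(** * Linear systems driven by a disturbance at one node *)

Section Driven.
Variables (n : nat) (a : nat -> S) (u : nat -> vec n) (H : nat -> S -> vec n).

(** [Q k s t] is the weight from s to t: unit sums over s mean averaging, unit sums over t mean
    conservation of mass. The disturbance enters before the mixing. *)
Definition driven : Prop := forall k t c,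
  H k.+1 t c = \big[Rplus/R0]_s (Q k s t * (H k s c + (if s == a k then u k c else 0))).

Hypothesis HH : driven.

(* The state of node r at time k + m if the disturbance were switched off from time k on. *)
Definition forecast k m r : vec n := vcomb (fun s => transfer k m s r) (H k).

Lemma forecast0 k r : forecast k 0 r = H k r.
Proof.
apply: functional_extensionality => c; rewrite /forecast /vcomb /=.
rewrite -[RHS](Rsum_delta r (fun s => H k s c)).
by apply: eq_bigr => s _; case: eqP => _; ring.
Qed.

(** Forecasts for the same final time made at k and at k + 1 differ only by the disturbance at k,
    scaled by the weight with which it reaches r. *)
Lemma forecast_step k m r : forecast k.+1 m r =
  vadd (forecast k m.+1 r) (vscale (transfer k m.+1 (a k) r) (u k)).
Proof.
apply: functional_extensionality => c; rewrite /vadd /vscale /forecast /vcomb /=.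
under eq_bigr => s _ do rewrite HH Rsum_mull.
rewrite exchange_big /=.
rewrite -(Rsum_delta (a k) (fun s => \big[Rplus/R0]_t (Q k s t * transfer k.+1 m t r) * u k c)).
rewrite -Rsum_add; apply: eq_bigr => s _.
transitivity (\big[Rplus/R0]_t (Q k s t * transfer k.+1 m t r) *
              (H k s c + (if s == a k then u k c else 0))).
  by rewrite Rsum_mulr; apply: eq_bigr => t _; ring.
by case: eqP => _; ring.
Qed.

Hypothesis T1 : forall k m s t, transfer k m s t <= 1.

Lemma forecast_error k m r :
  vnorm (vsub (H (k + m) r) (forecast k m r)) <= \big[Rplus/R0]_(l < m) vnorm (u (k + l)).
Proof.
elim: m k => [|m IH] k.
  by rewrite addn0 forecast0 vsubxx vnorm_vzero big_ord0; lra.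
have := IH k.+1; rewrite addSnnS forecast_step big_ord_recl addn0 => h.
have -> : vsub (H (k + m.+1) r) (forecast k m.+1 r) =
  vadd (vsub (H (k + m.+1) r) (vadd (forecast k m.+1 r) (vscale (transfer k m.+1 (a k) r) (u k))))
       (vscale (transfer k m.+1 (a k) r) (u k)).
  by apply: functional_extensionality => c; rewrite /vsub /vadd; ring.
have := vnorm_add (vsub (H (k + m.+1) r)
         (vadd (forecast k m.+1 r) (vscale (transfer k m.+1 (a k) r) (u k))))
       (vscale (transfer k m.+1 (a k) r) (u k)).
rewrite vnorm_scale_ge0; last exact: transfer_ge0.
rewrite (eq_bigr (fun l : 'I_m => vnorm (u (k.+1 + l)))); last first.
  by move=> l _; rewrite addSnnS.
move: h; have := vnorm_ge0 (u k); have := T1 k m.+1 (a k) r; have := transfer_ge0 k m.+1 (a k) r.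
set N := \big[_/_]_(_ < _) _; nra.
Qed.

End Driven.

Section Averaging.
Hypothesis Q1 : forall k t, \big[Rplus/R0]_s Q k s t = 1.
Variables (n : nat) (a : nat -> S) (u : nat -> vec n) (H : nat -> S -> vec n).
Hypothesis HH : driven a u H.

(* All nodes put weight at least [beta] on the same node [s0], so they move jointly
   a fraction [beta] of the way from the old centre to the state of [s0]. *)
Lemma radius_contraction k K s0 beta x X :
  (forall t, beta <= transfer k K s0 t) -> 0 <= X ->
  (forall s, vnorm (vsub (H k s) x) <= X) ->
  exists y, forall t, vnorm (vsub (H (k + K) t) y) <=
    (1 - beta) * X + \big[Rplus/R0]_(l < K) vnorm (u (k + l)).
Proof.
move=> hb X0 hX; exists (vadd (vscale beta (H k s0)) (vscale (1 - beta) x)) => t.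
set y := vadd _ _.
apply: Rle_trans (vnorm_sub_triangle (forecast H k K t) _ _) _.
have := forecast_error HH (transfer_col_le1 Q1) k K t.
suff: vnorm (vsub (forecast H k K t) y) <= (1 - beta) * X by lra.
(* Removing [beta] at [s0] leaves nonnegative weights of total 1 - beta; the forecast minus [y] is
   their combination of the old differences from [x]. *)
pose p s := transfer k K s t - (if s == s0 then beta else 0).
have p0 s : 0 <= p s.
  rewrite /p; case: eqP => [->|_]; first by have := hb t; lra.
  by rewrite Rminus_0_r; apply: transfer_ge0.
have p1 : \big[Rplus/R0]_s p s = 1 - beta.
  by rewrite Rsum_sub transfer_col1 // (Rsum_delta s0 (fun _ => beta)).
rewrite -p1; have := vnorm_vcomb_le p0 hX; congr (vnorm _ <= _).
apply: functional_extensionality => c; rewrite /y /vsub /vadd /vscale /forecast /vcomb.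
rewrite -(Rsum_delta s0 (fun s => beta * H k s c)).
rewrite -p1 Rsum_mulr.
transitivity (\big[Rplus/R0]_j (transfer k K j t * H k j c) -
  (\big[Rplus/R0]_j ((if j == s0 then beta * H k j c else 0) + p j * x c)));
  last by rewrite Rsum_add.
by rewrite -Rsum_sub; apply: eq_bigr => s _; rewrite /p; case: eqP => _; ring.
Qed.

End Averaging.

Section Conservation.
Hypothesis Q1 : forall k s, \big[Rplus/R0]_t Q k s t = 1.
Variables (n : nat) (a : nat -> S) (u : nat -> vec n) (H : nat -> S -> vec n).
Hypothesis HH : driven a u H.

Definition mass k : vec n := fun c => \big[Rplus/R0]_s H k s c.

Lemma mass_step k : mass k.+1 = vadd (mass k) (u k).
Proof.
apply: functional_extensionality => c; rewrite /mass /vadd.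
under eq_bigr => t _ do rewrite HH.
rewrite exchange_big /= -[X in _ + X](Rsum_delta (a k) (fun _ => u k c)) -Rsum_add.
by apply: eq_bigr => s _; rewrite -Rsum_mulr Q1; ring.
Qed.

Lemma mass_drift k m :
  vnorm (vsub (mass (k + m)) (mass k)) <= \big[Rplus/R0]_(l < m) vnorm (u (k + l)).
Proof.
elim: m => [|m IH]; first by rewrite addn0 vsubxx vnorm_vzero big_ord0; lra.
rewrite addnS mass_step big_ord_recr /=.
have -> : vsub (vadd (mass (k + m)) (u (k + m))) (mass k) =
  vadd (vsub (mass (k + m)) (mass k)) (u (k + m)).
  by apply: functional_extensionality => c; rewrite /vsub /vadd; ring.
apply: Rle_trans (vnorm_add _ _) _.
by apply: Rplus_le_compat_r; exact: IH.
Qed.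

(* [transfer 0 k o] is the push-sum weight: how a unit mass put on [o] is spread at time k. *)
Definition deviation o k s : vec n := vsub (H k s) (vscale (transfer 0 k o s) (mass k)).

Lemma deviation_sum o k c : \big[Rplus/R0]_s deviation o k s c = 0.
Proof.
rewrite /deviation /vsub /vscale Rsum_sub -Rsum_mulr transfer_row1 //.
by rewrite /mass; ring.
Qed.

(* All nodes send at least a fraction [beta] of their mass to [t0]; for a signed mass
   distribution of total zero these fractions cancel. *)
Lemma deviation_contraction o k K t0 beta :
  (forall s, beta <= transfer k K s t0) ->
  \big[Rplus/R0]_t vnorm (deviation o (k + K) t) <=
    (1 - beta) * \big[Rplus/R0]_s vnorm (deviation o k s) +
    INR #|S| * (2 * \big[Rplus/R0]_(l < K) vnorm (u (k + l))).
Proof.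
move=> hb; set N := \big[Rplus/R0]_(l < K) _.
(* Lowering all weights into [t0] by the constant [beta] changes nothing when they are summed
   against the deviations, which total zero. *)
pose p t s := transfer k K s t - (if t == t0 then beta else 0).
have p0 t s : 0 <= p t s.
  rewrite /p; case: eqP => [->|_]; first by have := hb s; lra.
  by rewrite Rminus_0_r; apply: transfer_ge0.
have main t : vnorm (deviation o (k + K) t) <=
    \big[Rplus/R0]_s (p t s * vnorm (deviation o k s)) + 2 * N.
  (* Besides the contracted part there remain the forecast error and the weighted drift of the mass,
     each at most [N]; hence the factor 2. *)
  have -> : deviation o (k + K) t = vadd (vcomb (p t) (deviation o k))
     (vsub (vsub (H (k + K) t) (forecast H k K t))
           (vscale (transfer 0 (k + K) o t) (vsub (mass (k + K)) (mass k)))).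
    apply: functional_extensionality => c; rewrite {1}/deviation /vadd /vsub /vscale.
    suff -> : vcomb (p t) (deviation o k) c =
      forecast H k K t c - transfer 0 (k + K) o t * mass k c by ring.
    transitivity (\big[Rplus/R0]_s (transfer k K s t * deviation o k s c -
                    (if t == t0 then beta else 0) * deviation o k s c)).
      by apply: eq_bigr => s _; rewrite /p; ring.
    rewrite Rsum_sub -[X in _ - X]Rsum_mull deviation_sum Rmult_0_r Rminus_0_r.
    rewrite transfer_add add0n Rsum_mulr -Rsum_sub.
    by apply: eq_bigr => s _; rewrite /deviation /vsub /vscale; ring.
  apply: Rle_trans (vnorm_add _ _) _.
  apply: Rplus_le_compat; first exact: vnorm_vcomb.
  apply: Rle_trans (vnorm_sub _ _) _.
  have := forecast_error HH (transfer_row_le1 Q1) k K t; rewrite -/N.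
  have := mass_drift k K; rewrite -/N.
  rewrite vnorm_scale_ge0; last exact: transfer_ge0.
  have := transfer_row_le1 Q1 0 (k + K) o t.
  have := transfer_ge0 0 (k + K) o t.
  have := vnorm_ge0 (vsub (mass (k + K)) (mass k)); nra.
apply: Rle_trans (Rsum_le (index_enum S) (fun t _ => main t)) _.
rewrite Rsum_add Rsum_const; apply: Rplus_le_compat_r.
rewrite exchange_big Rsum_mull /=; apply: Req_le; apply: eq_bigr => s _.
by rewrite -Rsum_mulr Rsum_sub transfer_row1 // (Rsum_delta t0 (fun _ => beta)).
Qed.

End Conservation.

End Transfer.

(** * Gradient steps on a strongly convex sum *)

Lemma Rabs_le_inv x a : Rabs x <= a -> - a <= x <= a.
Proof. by have := Rle_abs x; have := Rle_abs (- x); rewrite Rabs_Ropp; lra. Qed.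

Lemma uniform_radius (J : finType) (P : J -> R -> Prop) :
  (forall j, exists d, 0 < d /\ P j d) ->
  (forall j d d', 0 < d' <= d -> P j d -> P j d') ->
  exists d, 0 < d /\ forall j, P j d.
Proof.
move=> ex dn.
suff [d [d0 hd]] : exists d, 0 < d /\ forall j, j \in enum J -> P j d.
  by exists d; split=> // j; apply: hd; rewrite mem_enum.
elim: (enum J) => [|j s [d [d0 IH]]]; first by exists 1; split; [lra|].
have [e [e0 he]] := ex j; exists (Rmin d e).
have h0 : 0 < Rmin d e by apply: Rmin_glb_lt.
split=> // i; rewrite inE => /orP [/eqP ->|/IH hi].
  by apply: dn he; split=> //; apply: Rmin_r.
by apply: dn hi; split=> //; apply: Rmin_l.
Qed.

Section Objective.
Variables (n I : nat) (f : 'I_I -> vec n -> R) (grad : 'I_I -> vec n -> vec n).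

Definition gradsum (y : 'I_I -> vec n) : vec n :=
  fun c => \big[Rplus/R0]_i grad i (y i) c.

Lemma has_gradient_sumf : (forall i, has_gradient (f i) (grad i)) ->
  has_gradient (sumf f) (fun y => gradsum (fun _ => y)).
Proof.
move=> Hg x eps e0.
have I0 := pos_INR I.
pose e := eps / (INR I + 1).
have ee : 0 < e by apply: Rdiv_lt_0_compat; lra.
have [d [d0 hd]] := @uniform_radius _ (fun i d => forall h, vnorm h < d ->
   Rabs (f i (vadd x h) - f i x - dot (grad i x) h) <= e * vnorm h)
   (fun i => Hg i x e ee) (fun i d d' dd hd h hh => hd h (Rlt_le_trans _ _ _ hh (proj2 dd))).
exists d; split=> // h hh.
have -> : sumf f (vadd x h) - sumf f x - dot (gradsum (fun=> x)) h =
  \big[Rplus/R0]_i (f i (vadd x h) - f i x - dot (grad i x) h).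
  rewrite !Rsum_sub; congr (_ - _).
  rewrite /dot /gradsum exchange_big; apply: eq_bigr => c _.
  by rewrite Rsum_mulr.
have hb : \big[Rplus/R0]_(i < I) (e * vnorm h) <= eps * vnorm h.
  rewrite Rsum_const card_ord -Rmult_assoc; apply: Rmult_le_compat_r; first exact: vnorm_ge0.
  apply: (Rmult_le_reg_r (INR I + 1)); first lra.
  by rewrite /e; field_simplify; nra.
apply: Rle_trans hb; apply: Rabs_le; split.
  have -> x' : - x' = -1 * x' by ring.
  rewrite Rsum_mull; apply: Rsum_le => i _.
  have := hd i h hh; move/Rabs_le_inv; lra.
by apply: Rsum_le => i _; have := hd i h hh; move/Rabs_le_inv; lra.
Qed.

Lemma gradsum_lipschitz (L : 'I_I -> R) (y : 'I_I -> vec n) x X :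
  (forall i, lipschitz (grad i) (L i)) -> (forall i, vnorm (vsub (y i) x) <= X) ->
  vnorm (vsub (gradsum y) (gradsum (fun _ => x))) <= \big[Rplus/R0]_i Rabs (L i) * X.
Proof.
move=> HL hX.
have -> : vsub (gradsum y) (gradsum (fun=> x)) =
  fun c => \big[Rplus/R0]_i vsub (grad i (y i)) (grad i x) c.
  by apply: functional_extensionality => c; rewrite /vsub /gradsum -Rsum_sub.
apply: Rle_trans (vnorm_sum (index_enum _) (fun i => vsub (grad i (y i)) (grad i x))) _.
rewrite Rsum_mulr; apply: Rsum_le => i _.
apply: Rle_trans (HL i _ _) _.
have := hX i; have := vnorm_ge0 (vsub (y i) x); have := Rle_abs (L i); have := Rabs_pos (L i); nra.
Qed.

End Objective.

Section StrongConvexity.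
Variables (n : nat) (F : vec n -> R) (G : vec n -> vec n) (tau : R) (xs : vec n).
Hypotheses (HG : has_gradient F G) (Hsc : strongly_convex F tau).
Hypothesis Hmin : forall y, F xs <= F y.

(** The usual limit t -> 0 in the convexity inequality at x + t (y - x), run by contradiction: if
    the bound failed by [del], one small t would already violate it. *)
Lemma strongly_convex_first_order x y :
  F x + dot (G x) (vsub y x) + tau / 2 * vnorm (vsub y x) ^ 2 <= F y.
Proof.
have [t0 sc] := Hsc; set N := vnorm (vsub y x).
have N0 : 0 <= N by apply: vnorm_ge0.
apply: Rnot_lt_le => hlt; set gap := _ + _ + _ in hlt.
pose del := gap - F y; have del0 : 0 < del by rewrite /del; lra.
have e0 : 0 < del / (4 * (N + 1)) by apply: Rdiv_lt_0_compat; lra.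
have [d [d0 hd]] := HG x e0.
(* The three bounds keep t in [0, 1], keep the displacement within the radius of differentiability,
   and make the loss t tau N^2 / 2 at most del / 8. *)
pose t := Rmin (Rmin 1 (d / (2 * (N + 1)))) (del / (4 * (tau * N ^ 2 + 1))).
have tN : 0 <= tau * N ^ 2 by nra.
have tpos : 0 < t.
  by apply: Rmin_glb_lt; [apply: Rmin_glb_lt; [lra|]|]; apply: Rdiv_lt_0_compat; lra.
have t1 : t <= 1 by apply: Rle_trans (Rmin_l _ _) (Rmin_l _ _).
have td : t * (2 * (N + 1)) <= d.
  have: t <= d / (2 * (N + 1)) by apply: Rle_trans (Rmin_l _ _) (Rmin_r _ _).
  move/(Rmult_le_compat_r (2 * (N + 1))) => /(_ ltac:(lra)).
  by rewrite /Rdiv Rmult_assoc Rinv_l; lra.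
have te : t * (4 * (tau * N ^ 2 + 1)) <= del.
  have: t <= del / (4 * (tau * N ^ 2 + 1)) by apply: Rmin_r.
  move/(Rmult_le_compat_r (4 * (tau * N ^ 2 + 1))) => /(_ ltac:(lra)).
  by rewrite /Rdiv Rmult_assoc Rinv_l; lra.
have nh : vnorm (vscale t (vsub y x)) = t * N by rewrite vnorm_scale_ge0 //; lra.
have := hd (vscale t (vsub y x)); rewrite nh => /(_ ltac:(nra)) /Rabs_le_inv [h1 _].
have := sc y x t (conj (Rlt_le _ _ tpos) t1); rewrite -/N.
have -> : vadd (vscale t y) (vscale (1 - t) x) = vadd x (vscale t (vsub y x)).
  by apply: functional_extensionality => c; rewrite /vadd /vscale /vsub; ring.
move: h1; rewrite dot_scaler; set Fz := F (vadd _ _) => h1 h2.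
have h3 : del / (4 * (N + 1)) * (t * N) <= del / 4 * t.
  have -> : del / 4 * t = del / (4 * (N + 1)) * (t * (N + 1)) by field; lra.
  by apply: Rmult_le_compat_l; nra.
have h4 : t * (F x + dot (G x) (vsub y x) + tau / 2 * (1 - t) * N ^ 2 - F y - del / 4) <= 0.
  by nra.
have h5 : F x + dot (G x) (vsub y x) + tau / 2 * (1 - t) * N ^ 2 - F y - del / 4 <= 0.
  by apply: (Rmult_le_reg_l t) => //; lra.
by move: h5 te; rewrite /del /gap; nra.
Qed.

(** Otherwise a short step t along the negative gradient lowers F by at least t N^2 / 2: the linear
    term gives t N^2 and precision N / 2 costs at most half of it. *)
Lemma gradient_minimizer : G xs = @vzero n.
Proof.
apply: vnorm_eq0; set N := vnorm _.
have N0 : 0 <= N by apply: vnorm_ge0.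
apply: Rle_antisym => //; apply: Rnot_lt_le => Npos.
have e0 : 0 < N / 2 by lra.
have [d [d0 hd]] := HG xs e0.
pose t := d / (2 * (N + 1)).
have tpos : 0 < t by apply: Rdiv_lt_0_compat; lra.
have td : t * (2 * (N + 1)) = d by rewrite /t; field; lra.
have nh : vnorm (vscale (- t) (G xs)) = t * N.
  by rewrite vnorm_scale Rabs_Ropp Rabs_pos_eq //; lra.
have := hd (vscale (- t) (G xs)); rewrite nh => /(_ ltac:(nra)) /Rabs_le_inv [_ h1].
have := Hmin (vadd xs (vscale (- t) (G xs))); move: h1.
rewrite dot_scaler -vnorm_sqr -/N; have : 0 < t * N by nra.
nra.
Qed.

(** Add the first-order bounds at x and at the minimizer, where the gradient vanishes. *)
Lemma strongly_convex_monotone x :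
  tau * vnorm (vsub x xs) ^ 2 <= dot (G x) (vsub x xs).
Proof.
have := strongly_convex_first_order x xs; have := strongly_convex_first_order xs x.
rewrite gradient_minimizer dot_vzero (vnorm_sub_sym xs x).
have -> : vsub xs x = vscale (-1) (vsub x xs).
  by apply: functional_extensionality => c; rewrite /vscale /vsub; ring.
rewrite dot_scaler; lra.
Qed.

(** Expanding the square, monotonicity contributes -2 r tau and the condition on r L^2 at most r tau
    / 2, so the squared factor is 1 - (3/2) r tau, which is below (1 - (3/4) r tau)^2. *)
Lemma gradient_step_contraction L x r :
  vnorm (G x) <= L * vnorm (vsub x xs) -> 0 <= r -> r * tau <= 1 ->
  r * L ^ 2 <= tau / 2 ->
  vnorm (vsub (vsub x (vscale r (G x))) xs) <= (1 - 3 / 4 * r * tau) * vnorm (vsub x xs).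
Proof.
move=> hL r0 rt rL; have [tau0 _] := Hsc.
set N := vnorm (vsub x xs) in hL *; have N0 : 0 <= N by apply: vnorm_ge0.
apply: vnorm_le; first by nra.
have -> : vsub (vsub x (vscale r (G x))) xs = vsub (vsub x xs) (vscale r (G x)).
  by apply: functional_extensionality => c; rewrite /vscale /vsub; ring.
rewrite !(dot_subl _ (vscale _ _)) !(dot_subr _ (vscale _ _)) !dot_scalel !dot_scaler.
rewrite (dot_sym _ (G x)) -!vnorm_sqr -/N.
have hm := strongly_convex_monotone x; rewrite -/N in hm.
have hg : vnorm (G x) ^ 2 <= L ^ 2 * N ^ 2.
  by rewrite -Rpow_mult_distr; apply: pow_incr; split=> //; apply: vnorm_ge0.
have h1 : r * (r * vnorm (G x) ^ 2) <= r * (tau / 2) * N ^ 2.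
  rewrite Rmult_assoc; apply: Rmult_le_compat_l => //.
  by apply: Rle_trans (Rmult_le_compat_l r _ _ r0 hg) _; nra.
have h2 : r * (tau * N ^ 2) <= r * dot (G x) (vsub x xs) by apply: Rmult_le_compat_l.
have : 0 <= (r * tau * N) ^ 2 by nra.
nra.
Qed.

End StrongConvexity.

(** * Coupling of the three errors *)

Lemma bernoulli lam m : 0 <= lam <= 1 -> 1 - INR m * (1 - lam) <= lam ^ m.
Proof.
move=> hl; elim: m => [|m IH]; first by rewrite /=; lra.
have h1 : lam ^ m <= 1 by rewrite -(pow1 m); apply: pow_incr.
by rewrite S_INR /=; nra.
Qed.

Lemma pow_antitone lam m m' : 0 <= lam <= 1 -> (m <= m')%N -> lam ^ m' <= lam ^ m.
Proof.
move=> hl mm; rewrite -(subnKC mm) pow_add.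
have := pow_le lam m (proj1 hl).
have : lam ^ (m' - m) <= 1 by rewrite -(pow1 (m' - m)); apply: pow_incr.
nra.
Qed.

Lemma small_factor c e : 0 <= c -> 0 < e ->
  exists g, 0 < g /\ forall r, 0 < r <= g -> r * c <= e.
Proof.
move=> c0 e0; exists (e / (c + 1)); split; first by apply: Rdiv_lt_0_compat; lra.
move=> r [r0 hr]; have : r * (c + 1) <= e.
  have := Rmult_le_compat_r (c + 1) _ _ ltac:(lra) hr.
  by rewrite /Rdiv Rmult_assoc Rinv_l; lra.
by nra.
Qed.

(* [cons k X], [trk k] and [opt k Z] bound the consensus, tracking and optimality errors
   at time k; [nz] is the size of the direction, [du] that of the gradient increment.
   With the ansatz (a B lam^k, b B lam^k, B lam^k), [b] is chosen against the contraction
   rate of [opt], then [a] against [b], and finally the step size against [a]. *)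
Lemma three_scale_decay (K : nat) (eta tau Ls Sz : R) :
  (0 < K)%N -> 0 < eta <= 1 -> 0 < tau -> 1 <= Ls -> 1 <= Sz ->
  exists g0, 0 < g0 /\ g0 * tau * eta ^ 2 < 2 /\
  forall gam, 0 < gam <= g0 ->
  forall (cons : nat -> R -> Prop) (trk : nat -> R) (opt : nat -> R -> Prop) (nz du : nat -> R),
  (forall k X X', X <= X' -> cons k X -> cons k X') ->
  (forall k X X', X <= X' -> opt k X -> opt k X') ->
  (exists M, 0 < M /\ forall k, (k < K + K)%N -> [/\ cons k M, trk k <= M & opt k M]) ->
  (forall k X Z, 0 <= X -> cons k X -> (forall l, (l < K)%N -> nz (k + l)%N <= Z) ->
     cons (k + K)%N ((1 - eta) * X + INR K * (gam * Z))) ->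
  (forall k V, (forall l, (l < K)%N -> du (k + l)%N <= V) ->
     trk (k + K)%N <= (1 - eta) * trk k + Sz * (2 * (INR K * V))) ->
  (forall k X Z, (K <= k)%N -> 0 <= X -> 0 <= Z -> cons k X -> opt k Z ->
     opt k.+1 ((1 - 3 / 4 * gam * eta ^ 2 * tau) * Z + gam * (trk k + 2 * Ls * X))) ->
  (forall k X Z, (K <= k)%N -> cons k X -> opt k Z -> nz k <= trk k + Ls * (2 * X + Z)) ->
  (forall k X, cons k X -> du k <= Ls * (2 * X + gam * nz k)) ->
  exists B, forall k,
    let lam := 1 - tau * eta ^ 2 * gam / 2 in cons k (B * lam ^ k) /\ opt k (B * lam ^ k).
Proof.
move=> K0 eta0 tau0 Ls1 Sz1.
have Kr1 : 1 <= INR K by apply: (le_INR 1); apply/leP.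
set Kr := INR K in Kr1 *.
have te : 0 < tau * eta ^ 2 by apply: Rmult_lt_0_compat => //; nra.
pose C2 := 1 + 3 * Ls.
have KL : 0 < Kr * Ls by nra.
have SKL : 0 < Sz * (Kr * Ls) by nra.
(* The optimality recursion contracts by 1 - (3/4) tau eta^2 gam while [lam] asks only for half of
   tau eta^2 gam; [b] and a (2 Ls) each take half of the slack. *)
pose b := Rmin 1 (tau * eta ^ 2 / 8).
have b0 : 0 < b by apply: Rmin_glb_lt; lra.
have b1 : b <= 1 by apply: Rmin_l.
have bt : b <= tau * eta ^ 2 / 8 by apply: Rmin_r.
have be : 0 < b * eta / 4 by nra.
have [a1 [a10 ha1]] := small_factor (c := 2 * Ls) (e := tau * eta ^ 2 / 8) ltac:(lra) ltac:(lra).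
have [a2 [a20 ha2]] := small_factor (c := 4 * (Sz * (Kr * Ls))) (e := b * eta / 4) ltac:(lra) be.
(* The bound [a2] limits the share of the consensus error in the tracking recursion to b eta / 4. *)
pose a := Rmin 1 (Rmin a1 a2).
have a0 : 0 < a by apply: Rmin_glb_lt; [lra | apply: Rmin_glb_lt].
have aone : a <= 1 by apply: Rmin_l.
have aL : a * (2 * Ls) <= tau * eta ^ 2 / 8.
  by apply: ha1; split=> //; apply: Rle_trans (Rmin_r _ _) (Rmin_l _ _).
have aS : a * (4 * (Sz * (Kr * Ls))) <= b * eta / 4.
  by apply: ha2; split=> //; apply: Rle_trans (Rmin_r _ _) (Rmin_r _ _).
have ae : 0 < a * eta / 4 by nra.
have C20 : 0 < C2 by rewrite /C2; lra.
have KC : 0 <= Kr * C2 by nra.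
have SKC : 0 <= 2 * (Sz * (Kr * Ls)) * C2 by nra.
have KT : 0 <= Kr * (tau * eta ^ 2 / 2) by nra.
(* [g1] and [g2] limit the step-size terms of consensus and tracking to a eta / 4 and b eta / 4;
   [g3] ensures lam^K >= 1 - eta / 4, so both recursions close. *)
have [g1 [g10 hg1]] := small_factor KC ae.
have [g2 [g20 hg2]] := small_factor SKC be.
have [g3 [g30 hg3]] := small_factor (e := eta / 4) KT ltac:(lra).
exists (Rmin g1 (Rmin g2 g3)); split; first by do 2!(apply: Rmin_glb_lt => //).
have le2 : Rmin g1 (Rmin g2 g3) <= g2 by apply: Rle_trans (Rmin_r _ _) (Rmin_l _ _).
have le3 : Rmin g1 (Rmin g2 g3) <= g3 by apply: Rle_trans (Rmin_r _ _) (Rmin_r _ _).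
have le1 := Rmin_l g1 (Rmin g2 g3).
have lampos r : 0 < r <= Rmin g1 (Rmin g2 g3) -> r * (tau * eta ^ 2 / 2) <= 1 / 4.
  move=> [r0 hr]; have := hg3 r ltac:(lra).
  have : 0 < r * (tau * eta ^ 2 / 2) by apply: Rmult_lt_0_compat; lra.
  by nra.
split.
  have h : 0 < Rmin g1 (Rmin g2 g3) by do 2!(apply: Rmin_glb_lt => //).
  by have := lampos _ (conj h (Rle_refl _)); lra.
move=> gam [gam0 hgam] cons trk opt nz du mc mo [M [M0 base]] H1 H2 H3 H4 H5.
have {hg1} G1 := hg1 gam ltac:(lra); have {hg2} G2 := hg2 gam ltac:(lra).
have {hg3} G3 := hg3 gam ltac:(lra); have L4 := lampos gam (conj gam0 hgam).
pose lam := 1 - tau * eta ^ 2 * gam / 2.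
have lam0 : 0 < lam by rewrite /lam; lra.
have lam1 : lam <= 1 by rewrite /lam; nra.
have lamI : 0 <= lam <= 1 by lra.
have lamK : 1 - eta / 4 <= lam ^ K.
  by apply: Rle_trans (bernoulli K lamI); rewrite -/Kr /lam; lra.
have pw k : 0 < lam ^ k by apply: pow_lt.
(* [B] is chosen so large that M lies below all three bounds on the first two windows; a, b <= 1
   lets the product a b serve for each. *)
pose w := a * b * lam ^ (K + K).
have w0 : 0 < w by rewrite /w; do 2!(apply: Rmult_lt_0_compat => //).
pose B := M / w.
have BM : B * w = M by rewrite /B; field; lra.
have B0 : 0 < B by apply: Rdiv_lt_0_compat.
have init k : (k < K + K)%N -> M <= a * b * (B * lam ^ k).
  move=> hk; have := pow_antitone lamI (ltnW hk) => h.
  rewrite -BM /w; have ab : 0 < a * b by nra.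
  have -> : B * (a * b * lam ^ (K + K)) = a * b * (B * lam ^ (K + K)) by ring.
  by apply: Rmult_le_compat_l; [lra | apply: Rmult_le_compat_l; lra].
suff P k : [/\ cons k (a * (B * lam ^ k)), trk k <= b * (B * lam ^ k) & opt k (B * lam ^ k)].
  exists B => k; have [h1 _ h3] := P k; split=> //; apply: mc h1.
  rewrite -/lam; have : 0 < B * lam ^ k by apply: Rmult_lt_0_compat.
  by nra.
elim/ltn_ind: k => k IH.
have Bk j : 0 < B * lam ^ j by apply: Rmult_lt_0_compat.
have [hk|hk] := ltnP k (K + K).
  have [c1 c2 c3] := base k hk; have := init k hk => hM.
  have abB : a * b * (B * lam ^ k) <= a * (B * lam ^ k) by have := Bk k; nra.
  have abB' : a * b * (B * lam ^ k) <= b * (B * lam ^ k) by have := Bk k; nra.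
  split; [apply: mc c1; lra | lra | apply: mo c3; have := Bk k; nra].
have Kk : (K <= k)%N by apply: leq_trans hk; apply: leq_addr.
(* One window back. Two base windows guarantee K <= j, so the direction bound holds throughout the
   window from j to k. *)
pose j := (k - K)%N; have ej : (j + K)%N = k by rewrite subnK.
have Kj : (K <= j)%N by rewrite -(leq_add2r K) ej.
have ltjk l : (l < K)%N -> (j + l < k)%N by rewrite -ej ltn_add2l.
have jk : (j < k)%N by rewrite -ej -[X in (X < _)%N]addn0 ltn_add2l.
have nzb l : (l < k)%N -> (K <= l)%N -> nz l <= C2 * (B * lam ^ l).
  move=> lk Kl; have [c1 c2 c3] := IH l lk; have := H4 l _ _ Kl c1 c3.
  have := Bk l; set x := B * lam ^ l in c2 * => x0 h.
  apply: Rle_trans h _; have : Ls * (a * x) <= Ls * x by apply: Rmult_le_compat_l; nra.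
  by rewrite /C2; nra.
have nzj l : (l < K)%N -> nz (j + l)%N <= C2 * (B * lam ^ j).
  move=> lK; apply: Rle_trans (nzb _ (ltjk l lK) (leq_trans Kj (leq_addr _ _))) _.
  apply: Rmult_le_compat_l; first lra; apply: Rmult_le_compat_l; first lra.
  by apply: pow_antitone lamI (leq_addr _ _).
have duj l : (l < K)%N -> du (j + l)%N <= Ls * (2 * a + gam * C2) * (B * lam ^ j).
  move=> lK; have [c1 _ _] := IH _ (ltjk l lK).
  apply: Rle_trans (H5 _ _ c1) _; rewrite Rmult_assoc; apply: Rmult_le_compat_l; first lra.
  have h := nzj l lK; have h' : gam * nz (j + l)%N <= gam * (C2 * (B * lam ^ j)).
    by apply: Rmult_le_compat_l; lra.
  have : a * (B * lam ^ (j + l)) <= a * (B * lam ^ j).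
    apply: Rmult_le_compat_l; first lra; apply: Rmult_le_compat_l; first lra.
    by apply: pow_antitone lamI (leq_addr _ _).
  by lra.
have [cj tj _] := IH j jk.
have Bkj : B * lam ^ k = B * lam ^ j * lam ^ K by rewrite -ej pow_add; ring.
have Bj := Bk j; set x := B * lam ^ j in cj tj nzj duj Bkj Bj *.
split.
- have := H1 j _ _ _ cj nzj; rewrite ej => /(_ ltac:(nra)).
  apply: mc; rewrite Bkj -/Kr.
  have -> : (1 - eta) * (a * x) + Kr * (gam * (C2 * x)) =
            ((1 - eta) * a + gam * (Kr * C2)) * x by ring.
  have -> : a * (x * lam ^ K) = a * lam ^ K * x by ring.
  apply: Rmult_le_compat_r; first lra.
  by nra.
- have := H2 j _ duj; rewrite ej => h; apply: Rle_trans h _; rewrite Bkj -/Kr.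
  have h : (1 - eta) * trk j <= (1 - eta) * (b * x) by apply: Rmult_le_compat_l; lra.
  apply: Rle_trans (Rplus_le_compat_r _ _ _ h) _.
  have -> : (1 - eta) * (b * x) + Sz * (2 * (Kr * (Ls * (2 * a + gam * C2) * x))) =
    ((1 - eta) * b + a * (4 * (Sz * (Kr * Ls))) + gam * (2 * (Sz * (Kr * Ls)) * C2)) * x by ring.
  have -> : b * (x * lam ^ K) = b * lam ^ K * x by ring.
  apply: Rmult_le_compat_r; first lra.
  by nra.
- have ek : k.-1.+1 = k by apply: prednK; apply: leq_ltn_trans jk.
  have Kk1 : (K <= k.-1)%N.
    by rewrite -ltnS ek -ej; apply: leq_ltn_trans Kj _; rewrite ej.
  have k1k : (k.-1 < k)%N by rewrite ek.
  have [c1 c2 c3] := IH _ k1k; have Bk1 := Bk k.-1.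
  have := H3 _ _ _ Kk1 _ _ c1 c3; rewrite ek => /(_ ltac:(nra) ltac:(lra)).
  have lk : lam ^ k = lam * lam ^ k.-1 by rewrite -{1}ek.
  apply: mo; rewrite lk.
  set y := B * lam ^ k.-1 in c2 Bk1 *.
  have -> : B * (lam * lam ^ k.-1) = lam * y by rewrite /y; ring.
  have h : gam * (trk k.-1 + 2 * Ls * (a * y)) <= gam * ((b + a * (2 * Ls)) * y).
    by apply: Rmult_le_compat_l; lra.
  have h' : (b + a * (2 * Ls)) * y <= tau * eta ^ 2 / 4 * y by apply: Rmult_le_compat_r; lra.
  have h'' := Rmult_le_compat_l gam _ _ ltac:(lra) h'.
  by rewrite /lam; lra.
Qed.

Lemma Rsum_pair (J1 J2 : finType) (F : J1 * J2 -> R) :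
  \big[Rplus/R0]_p F p = \big[Rplus/R0]_i \big[Rplus/R0]_j F (i, j).
Proof. by rewrite pair_bigA; apply: eq_bigr => -[]. Qed.

Lemma Rsum_one (J : finType) (i : J) (F : J -> R) :
  (forall j, j != i -> F j = 0) -> \big[Rplus/R0]_j F j = F i.
Proof. by move=> h; rewrite (bigD1 i) //= big1 ?Rplus_0_r. Qed.

(** * The averaging and pushing networks with delay nodes *)

Section Hops.
Variables (I : nat) (E : rel 'I_I) (S : finType) (Q : nat -> S -> S -> R) (mbar : R).
Variable (emb : 'I_I -> S).
Hypothesis stay : forall k i, mbar <= Q k (emb i) (emb i).

Lemma reach_stay k k' i : (k <= k')%N -> reach Q mbar k (emb i) k' (emb i).
Proof.
move=> /subnKC <-; elim: (k' - k)%N => [|m IH]; first by rewrite addn0; constructor.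
by rewrite addnS; apply: reach_step IH _; apply: stay.
Qed.

(** A connecting path shortened to distinct vertices has at most I - 1 edges of h steps each; the
    time left over is spent waiting at the end. *)
Lemma reach_hops h k i j : (forall i j, connect E i j) ->
  (forall k i j, E i j -> reach Q mbar k (emb i) (k + h)%N (emb j)) ->
  reach Q mbar k (emb i) (k + I.-1 * h)%N (emb j).
Proof.
move=> conn hop; have /connectP [p0 + ->] := conn i j.
move=> /shortenP [p pp up _].
have szp : (size p <= I.-1)%N.
  have := max_card [in i :: p]; rewrite (card_uniqP up) card_ord /=.
  by move=> le; rewrite -ltnS (leq_trans le) ?leqSpred.
apply: (@reach_trans _ _ _ _ _ (k + size p * h)%N (emb (last i p))); last first.
  by apply: reach_stay; rewrite leq_add2l leq_mul2r szp orbT.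
elim: p {up szp} i k pp => [|a p IH] i k /=; first by rewrite mul0n addn0; constructor.
case/andP=> /hop ia /IH pa; apply: reach_trans (ia k) _.
by have := pa (k + h)%N; rewrite mulSn addnA.
Qed.
End Hops.

(** I - 1 hops of 2T + D steps, plus T + D steps to get into or out of the delay nodes. *)
Lemma window_length (I T D : nat) : (0 < I)%N ->
  (I.-1 * (T + T + D) + (T + D) = (2 * I - 1) * T + I * D)%N.
Proof. by nia. Qed.

Section Network.
Variables (I D T : nat) (E : rel 'I_I) (mbar : R) (ik : nat -> 'I_I).
Variable dl : nat -> 'I_I -> 'I_D.+1.
Hypothesis HE : strongly_connected_noloop E.
Hypothesis Hm : 0 < mbar < 1.
Hypothesis Hact : forall k a, exists t, (k <= t)%nat /\ (t < k + T)%nat /\ ik t = a.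

Section Averaging.
Variable W : 'I_I -> 'I_I -> R.
Hypothesis HW : row_stochastic W /\ weight_pattern E W mbar.

(* At time k, [inl i] carries x_i^k and [inr (i, d)] carries v_i^(k-d); the active agent
   reads v_j with delay [dl k j]. *)
Definition avg_node : finType := ('I_I + 'I_I * 'I_D.+1)%type.

Definition avg_mix k (s : avg_node) : R :=
  match s with
  | inl i => if i == ik k then W i i else 0
  | inr (j, e) => if E j (ik k) && (e == dl k j) then W (ik k) j else 0
  end.

Definition avg_src k (t : avg_node) : avg_node :=
  match t with
  | inl i => inl i
  | inr (i, e) => if (e : nat) is e'.+1 then inr (i, inord e')
                  else if i == ik k then inl i else inr (i, e)
  end.

Definition avg_weight k (s t : avg_node) : R :=
  if t == inl (ik k) then avg_mix k s else if s == avg_src k t then 1 else 0.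

Lemma weight_ge0 (M : 'I_I -> 'I_I -> R) i j : weight_pattern E M mbar -> 0 <= M i j.
Proof.
move=> [Md [Me M0]]; have [->|nij] := eqVneq i j; first by have := Md j; lra.
by case: (boolP (E j i)) => [/Me|/(M0 _ _ nij) ->]; lra.
Qed.

Lemma avg_weight_ge0 k s t : 0 <= avg_weight k s t.
Proof.
have w0 i j := weight_ge0 i j (proj2 HW).
rewrite /avg_weight; case: ifP => _; last by case: ifP => _; lra.
by case: s => [i|[j e]] /=; case: ifP => _ //; lra.
Qed.

(** The active agent sees its row of [W], each in-neighbour's entry placed at exactly one delay; the
    absence of self-loops keeps the diagonal from being counted twice. *)
Lemma avg_weight_col k t : \big[Rplus/R0]_s avg_weight k s t = 1.
Proof.
rewrite /avg_weight; case: (t == inl (ik k)); last exact: (Rsum_delta _ (fun _ => 1)).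
rewrite big_sumType /= Rsum_pair.
rewrite (Rsum_delta (ik k) (fun i => W i i)) -[RHS](proj1 HW (ik k)) [RHS](bigD1 (ik k)) //=.
congr (_ + _); rewrite [RHS]big_mkcond; apply: eq_bigr => j _.
have [_ [_ M0]] := proj2 HW; have [_ nl] := HE.
case: (boolP (E j (ik k))) => Ej /=.
  rewrite (Rsum_delta (dl k j) (fun _ => W (ik k) j)).
  by case: eqP => // ej; move: Ej; rewrite ej (negPf (nl _)).
rewrite big1 //; case: ifP => // nj; rewrite M0 // eq_sym; exact: nj.
Qed.

Lemma avg_stay k i : mbar <= avg_weight k (inl i) (inl i).
Proof.
rewrite /avg_weight /=; case: eqP => [[<-]|_]; first by rewrite eqxx; apply: (proj1 (proj2 HW)).
by rewrite eqxx; lra.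
Qed.

Local Notation areach := (reach avg_weight mbar).

(** The last activation of i before t copies [inl i] into the undelayed node, which then keeps its
    value while i is idle. *)
Lemma avg_reach_fresh k i t1 t : (k <= t1)%N -> (t1 < t)%N -> ik t1 = i ->
  areach k (inl i) t (inr (i, ord0)).
Proof.
move=> kt1 + it1; elim: t => [//|t IH]; rewrite ltnS leq_eqVlt => lt.
have [it|it] := eqVneq (ik t) i.
  apply: (@reach_step _ _ _ _ _ _ (inl i)).
    apply: (reach_stay avg_stay); case/orP: lt => [/eqP <- //|].
    by move=> /ltnW; apply: leq_trans.
  by rewrite /avg_weight /= it !eqxx; lra.
case/orP: lt => [/eqP e|/IH h]; first by rewrite -e it1 eqxx in it.
apply: reach_step h _.
by rewrite /avg_weight /= [i == _]eq_sym (negPf it) eqxx; lra.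
Qed.

Lemma avg_reach_aged k i t (e : 'I_D.+1) : (k + T <= t)%N ->
  areach k (inl i) (t + e)%N (inr (i, e)).
Proof.
move=> kt; case: e => e; elim: e => [|e IH] he /=.
  rewrite addn0; have [t1 [h1 [h2 h3]]] := Hact k i.
  have -> : Ordinal he = ord0 by apply: val_inj.
  exact: avg_reach_fresh h1 (leq_trans h2 kt) h3.
rewrite addnS; apply: reach_step (IH (ltnW he)) _.
rewrite /avg_weight /=.
have -> : Ordinal (ltnW he) = inord e by apply: val_inj; rewrite /= inordK // ltnW.
by rewrite eqxx; lra.
Qed.

(** T steps to refresh the copy of i, up to D for it to age, and at most T more until j acts and
    reads it. *)
Lemma avg_hop k i j : E i j -> areach k (inl i) (k + (T + T + D))%N (inl j).
Proof.
move=> Eij; have [t [h1 [h2 h3]]] := Hact (k + T + D)%N j.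
have dt := ltn_ord (dl t i); rewrite ltnS in dt.
apply: (@reach_trans _ _ _ _ _ t.+1 (inl j)); last first.
  by apply: (reach_stay avg_stay); apply: leq_trans h2 _; rewrite -!addnA [(T + D)%N]addnC.
apply: (@reach_step _ _ _ _ _ _ (inr (i, dl t i))).
  have le : (dl t i <= t)%N by apply: leq_trans dt (leq_trans (leq_addl _ _) h1).
  have := @avg_reach_aged k i (t - dl t i) (dl t i); rewrite subnK //; apply.
  by rewrite leq_subRL // addnC; apply: leq_trans h1; rewrite leq_add2l.
rewrite /avg_weight /avg_mix h3 eqxx Eij eqxx /=.
by apply: (proj1 (proj2 (proj2 HW))).
Qed.

(** The hops come first; the final T + D steps carry the influence into the delay nodes. Any agent
    can thus be the common source in [radius_contraction]. *)
Lemma avg_reach k i t : areach k (inl i) (k + ((2 * I - 1) * T + I * D))%N t.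
Proof.
rewrite -window_length ?(leq_ltn_trans _ (ltn_ord i)) // addnA.
have h j := reach_hops avg_stay k i j (proj1 HE) avg_hop.
case: t => [j|[j e]]; apply: reach_trans (h j) _.
  by apply: (reach_stay avg_stay); apply: leq_addr.
have eD := ltn_ord e; rewrite ltnS in eD.
set m := (k + _)%N; have -> : (m + (T + D) = m + T + (D - e) + e)%N by lia.
by apply: avg_reach_aged; apply: leq_addr.
Qed.

End Averaging.

Section Pushing.
Variable A : 'I_I -> 'I_I -> R.
Hypothesis HA : col_stochastic A /\ weight_pattern E A mbar.

(* At time k, [inl i] carries z_i^k and [inr (i, (j, e))] the mass sent by j to i that i
   has not yet received and that is e steps old (at least D steps if e = D). *)
Definition push_node : finType := ('I_I + 'I_I * ('I_I * 'I_D.+1))%type.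

(** What the active agent collects now. The implication makes nodes without an edge always ready;
    they carry no mass, but in this way they too lead to an agent. *)
Definition push_ready k (s : push_node) : bool :=
  match s with
  | inl i => i == ik k
  | inr (i, (j, e)) => (i == ik k) && (E j i ==> (dl k j <= e)%N)
  end.

Definition push_spread k (t : push_node) : R :=
  match t with
  | inl i => if i == ik k then A i i else 0
  | inr (i, (j, e)) => if [&& j == ik k, e == ord0 & i != ik k] then A i j else 0
  end.

Definition push_move (s : push_node) : push_node :=
  match s with
  | inl i => inl i
  | inr (i, (j, e)) => inr (i, (j, inord (minn e.+1 D)))
  end.

Definition push_weight k (s t : push_node) : R :=
  if push_ready k s then push_spread k t else if t == push_move s then 1 else 0.

Lemma push_weight_ge0 k s t : 0 <= push_weight k s t.
Proof.
have w0 i j := weight_ge0 i j (proj2 HA).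
rewrite /push_weight; case: ifP => _; last by case: ifP => _; lra.
by case: t => [i|[i [j e]]] /=; case: ifP => _ //; lra.
Qed.

(** Ready mass is split by a column of [A]: the agent keeps the diagonal share, and each other share
    lands at one node of age zero. Unready mass moves as a whole. *)
Lemma push_weight_row k s : \big[Rplus/R0]_t push_weight k s t = 1.
Proof.
rewrite /push_weight; case: (push_ready k s); last exact: (Rsum_delta _ (fun _ => 1)).
rewrite big_sumType /= Rsum_pair.
rewrite (Rsum_delta (ik k) (fun i => A i i)) -[RHS](proj1 HA (ik k)) [RHS](bigD1 (ik k)) //=.
congr (_ + _); rewrite [RHS]big_mkcond; apply: eq_bigr => i _.
rewrite Rsum_pair (Rsum_one (i := ik k)); last first.
  by move=> j /negPf nj; rewrite big1 // => e _; rewrite nj.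
rewrite (Rsum_one (i := ord0)); first by rewrite !eqxx.
by move=> e /negPf ne; rewrite ne andbF.
Qed.

Lemma push_stay k i : mbar <= push_weight k (inl i) (inl i).
Proof.
rewrite /push_weight /=; case: eqP => [->|_]; first by apply: (proj1 (proj2 HA)).
by rewrite eqxx; lra.
Qed.

Local Notation preach := (reach push_weight mbar).

(** With m steps left until i acts at t, mass of age e will be at least D old by then, hence
    collected at t at the latest. If collected earlier, it waits at i. *)
Lemma push_deliver t i : ik t = i -> forall m k j (e : 'I_D.+1),
  (k + m = t)%N -> (D <= m + e)%N -> preach k (inr (i, (j, e))) t.+1 (inl i).
Proof.
move=> it; elim=> [|m IH] k j e kt De.
all: case: (boolP (push_ready k (inr (i, (j, e))))) => rd.
1,3: have ki : i == ik k by case/andP: rd.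
1,2: apply: (@reach_trans _ _ _ _ _ k.+1 (inl i));
  last by apply: (reach_stay push_stay); rewrite ltnS -kt leq_addr.
1,2: apply: reach_step (reach_refl _ _ _ _) _.
1,2: by rewrite /push_weight rd /= ki; apply: (proj1 (proj2 HA)).
(* At time t itself the age is D, which no delay exceeds. *)
- case/negP: rd; rewrite /= -it -kt addn0 eqxx /=; apply/implyP => _.
  by apply: leq_trans De; rewrite -ltnS.
- apply: (@reach_trans _ _ _ _ _ k.+1 (push_move (inr (i, (j, e))))); last first.
    apply: IH; first by rewrite addSnnS.
    rewrite inordK ?ltnS ?geq_minr // addn_minr leq_min addnS -addSn De /=.
    by rewrite leq_addl.
  apply: reach_step (reach_refl _ _ _ _) _.
  by rewrite /push_weight (negPf rd) eqxx; lra.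
Qed.

Lemma push_arrive k i j e : preach k (inr (i, (j, e))) (k + (T + D))%N (inl i).
Proof.
have [t [h1 [h2 h3]]] := Hact (k + D)%N i.
apply: (@reach_trans _ _ _ _ _ t.+1 (inl i)); last first.
  by apply: (reach_stay push_stay); rewrite [(T + D)%N]addnC addnA.
apply: (push_deliver h3 (m := (t - k)%N)).
  by rewrite subnKC //; apply: leq_trans h1; apply: leq_addr.
by apply: leq_trans (leq_addr _ _); rewrite leq_subRL //; apply: leq_trans h1; apply: leq_addr.
Qed.

(** Within T steps i acts and sends; T + D more steps bring the mass to j. *)
Lemma push_hop k i j : E i j -> preach k (inl i) (k + (T + T + D))%N (inl j).
Proof.
move=> Eij; have [t [h1 [h2 h3]]] := Hact k i.
apply: (@reach_trans _ _ _ _ _ t (inl i)); first exact: (reach_stay push_stay).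
apply: (@reach_trans _ _ _ _ _ t.+1 (inr (j, (i, ord0)))).
  apply: reach_step (reach_refl _ _ _ _) _.
  rewrite /push_weight /= h3 !eqxx /=.
  have -> : j != i by apply/eqP => ji; move: Eij; rewrite ji (negPf (proj2 HE _)).
  by apply: (proj1 (proj2 (proj2 HA))).
apply: reach_trans (push_arrive _ _ _ _) _; apply: (reach_stay push_stay).
by lia.
Qed.

(** Mirror image of averaging: T + D steps first clear the edge nodes, then the hops lead to i. *)
Lemma push_reach k s i : preach k s (k + ((2 * I - 1) * T + I * D))%N (inl i).
Proof.
rewrite -window_length ?(leq_ltn_trans _ (ltn_ord i)) // [(_ + (T + D))%N]addnC addnA.
have h i' := reach_hops push_stay (k + (T + D))%N i' i (proj1 HE) push_hop.
case: s => [j|[i' [j e]]].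
  by apply: reach_trans (h j); apply: (reach_stay push_stay); apply: leq_addr.
by apply: reach_trans (h i'); apply: push_arrive.
Qed.

End Pushing.
End Network.

(** Age classes hold increments of what was sent, so the mass of age at least p telescopes. *)
Lemma Rsum_telescope_from (F : nat -> R) m p :
  \big[Rplus/R0]_(e < m) (if (p <= e)%N then F e - F e.+1 else 0) =
  if (p <= m)%N then F p - F m else 0.
Proof.
elim: m => [|m IH]; first by rewrite big_ord0; case: p => //= ; ring.
rewrite big_ord_recr /= IH.
case: (leqP p m) => h1; case: (leqP p m.+1) => h2; try (exfalso; lia); try ring.
by have -> : p = m.+1 by [lia]; ring.
Qed.

(** * ASY-SONATA as a pair of driven linear systems *)

Section Trajectory.
Variables (n I : nat) (E : rel 'I_I) (W A : 'I_I -> 'I_I -> R) (mbar : R) (T D : nat).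
Variables (grad : 'I_I -> vec n -> vec n) (gamma : R).
Variables (ik : nat -> 'I_I) (d : nat -> 'I_I -> nat) (x z : nat -> 'I_I -> vec n)
  (v : Z -> 'I_I -> vec n) (rho : Z -> 'I_I -> 'I_I -> vec n)
  (rt : nat -> 'I_I -> 'I_I -> vec n) (tv : Z -> 'I_I -> 'I_I -> Z).
Hypothesis HE : strongly_connected_noloop E.
Hypothesis HA : weight_pattern E A mbar.
Hypothesis Had : admissible_asynchrony E T D ik d.
Hypothesis Hs : asy_sonata E W A grad (fun _ => gamma) D ik d x z v rho rt tv.

Definition pushed k : vec n :=
  vadd (vadd (z k (ik k))
             (vsum (fun j => E j (ik k))
                   (fun j => vsub (rho (tv (Z.of_nat k) (ik k) j) (ik k) j) (rt k (ik k) j))))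
       (vsub (grad (ik k) (x k.+1 (ik k))) (grad (ik k) (x k (ik k)))).

Lemma tv_active k j : E j (ik k) -> tv (Z.of_nat k) (ik k) j =
  Z.max (tv (Z.of_nat k - 1) (ik k) j) (Z.of_nat k - Z.of_nat (d k j)).
Proof. by have [_ [_ [_ [_ [_ h]]]]] := Hs; have [h1 _] := h k; apply: h1. Qed.

Lemma tv_idle k i j : ~ (i = ik k /\ E j (ik k)) ->
  tv (Z.of_nat k) i j = tv (Z.of_nat k - 1) i j.
Proof. by have [_ [_ [_ [_ [_ h]]]]] := Hs; have [_ [h1 _]] := h k; apply: h1. Qed.

Lemma v_active k : v (Z.of_nat k + 1) (ik k) = vsub (x k (ik k)) (vscale gamma (z k (ik k))).
Proof. by have [_ [_ [_ [_ [_ h]]]]] := Hs; have [_ [_ [h1 _]]] := h k. Qed.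

Lemma v_idle k i : i <> ik k -> v (Z.of_nat k + 1) i = v (Z.of_nat k) i.
Proof. by have [_ [_ [_ [_ [_ h]]]]] := Hs; have [_ [_ [_ [h1 _]]]] := h k; apply: h1. Qed.

Lemma x_active k : x k.+1 (ik k) = vadd (vscale (W (ik k) (ik k)) (v (Z.of_nat k + 1) (ik k)))
  (vsum (fun j => E j (ik k)) (fun j => vscale (W (ik k) j) (v (tv (Z.of_nat k) (ik k) j) j))).
Proof. by have [_ [_ [_ [_ [_ h]]]]] := Hs; have [_ [_ [_ [_ [h1 _]]]]] := h k. Qed.

Lemma x_idle k i : i <> ik k -> x k.+1 i = x k i.
Proof. by have [_ [_ [_ [_ [_ h]]]]] := Hs; have [_ [_ [_ [_ [_ [h1 _]]]]]] := h k; apply: h1. Qed.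

Lemma z_active k : z k.+1 (ik k) = vscale (A (ik k) (ik k)) (pushed k).
Proof. by have [_ [_ [_ [_ [_ h]]]]] := Hs; have [_ [_ [_ [_ [_ [_ [[h1 _] _]]]]]]] := h k. Qed.

Lemma rho_active k j : E (ik k) j ->
  rho (Z.of_nat k + 1) j (ik k) = vadd (rho (Z.of_nat k) j (ik k)) (vscale (A j (ik k)) (pushed k)).
Proof.
have [_ [_ [_ [_ [_ h]]]]] := Hs; have [_ [_ [_ [_ [_ [_ [[_ h1] _]]]]]]] := h k; exact: h1.
Qed.

Lemma z_idle k i : i <> ik k -> z k.+1 i = z k i.
Proof.
have [_ [_ [_ [_ [_ h]]]]] := Hs; have [_ [_ [_ [_ [_ [_ [_ [h1 _]]]]]]]] := h k; exact: h1.
Qed.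

Lemma rho_idle k i j : j <> ik k -> rho (Z.of_nat k + 1) i j = rho (Z.of_nat k) i j.
Proof.
have [_ [_ [_ [_ [_ h]]]]] := Hs; have [_ [_ [_ [_ [_ [_ [_ [_ [h1 _]]]]]]]]] := h k.
by move=> ne; apply: h1 => -[].
Qed.

Lemma tv_bounds k i j :
  (- Z.of_nat D <= tv (Z.of_nat k - 1) i j <= Z.of_nat k)%Z.
Proof.
elim: k => [|k IH] in i j *.
  by have [_ [_ [h _]]] := Hs; rewrite h; lia.
have -> : (Z.of_nat k.+1 - 1 = Z.of_nat k)%Z by lia.
case: (boolP ((i == ik k) && E j (ik k))) => [/andP [/eqP -> Ej]|/negP h].
  by rewrite tv_active //; have := IH (ik k) j; lia.
rewrite tv_idle; first by have := IH i j; lia.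
by move=> [e Ej]; apply: h; rewrite e eqxx.
Qed.

Lemma tv_mono k i j : (tv (Z.of_nat k - 1) i j <= tv (Z.of_nat k) i j <= Z.of_nat k)%Z.
Proof.
have b := tv_bounds k.
case: (boolP ((i == ik k) && E j (ik k))) => [/andP [/eqP -> Ej]|/negP h].
  by rewrite tv_active //; have := b (ik k) j; lia.
rewrite tv_idle; first by have := b i j; lia.
by move=> [e Ej]; apply: h; rewrite e eqxx.
Qed.

(** [rt] records [rho] at the last read time, so it can be eliminated in favour of [tv]. *)
Lemma rt_rho k i j : rt k i j = rho (tv (Z.of_nat k - 1) i j) i j.
Proof.
have [_ [h0 [h1 [h2 [_ h]]]]] := Hs.
elim: k => [|k IH] in i j *.
  by rewrite h0 h1 h2 //; lia.
have -> : (Z.of_nat k.+1 - 1 = Z.of_nat k)%Z by lia.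
have [_ [_ [_ [_ [_ [_ [_ [_ [_ [r1 r2]]]]]]]]]] := h k.
case: (boolP ((i == ik k) && E j (ik k))) => [/andP [/eqP -> Ej]|/negP h'].
  exact: r1.
have ne : ~ (i = ik k /\ E j (ik k)) by move=> [e Ej]; apply: h'; rewrite e eqxx.
by rewrite r2 // tv_idle.
Qed.

(** The effective delay after the max rule, possibly below [d k j]. For in-neighbours it is at most
    D, so [inord] is faithful there. *)
Definition read_delay k j : 'I_D.+1 :=
  inord (Z.to_nat (Z.of_nat k - tv (Z.of_nat k) (ik k) j)).

Lemma read_delayE k j : E j (ik k) ->
  Z.of_nat (read_delay k j) = (Z.of_nat k - tv (Z.of_nat k) (ik k) j)%Z.
Proof.
move=> Ej; have := tv_mono k (ik k) j; have := proj2 Had k j Ej; have := tv_active Ej.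
by move=> h1 h2 h3; rewrite /read_delay inordK; lia.
Qed.

Definition avg_state k (s : avg_node I D) : vec n :=
  match s with inl i => x k i | inr (i, e) => v (Z.of_nat k - Z.of_nat e) i end.

(** Injecting -gamma z before the mixing turns x_i^k into v_i^(k+1) for the active agent; this is
    both mixed into x_i^(k+1) and copied to the undelayed node. *)
Lemma avg_driven : driven (avg_weight E ik read_delay W) (fun k => inl (ik k))
  (fun k => vscale (- gamma) (z k (ik k))) avg_state.
Proof.
move=> k t c; rewrite /avg_weight.
have [->|nt] := eqVneq t (inl (ik k)).
  rewrite big_sumType /= Rsum_pair x_active v_active /vadd /vsub /vscale /vsum.
  rewrite [X in _ = X + _](Rsum_one (i := ik k)) ?eqxx; last first.
    by move=> i /negPf ni; rewrite ni; ring.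
  congr (_ + _); first by ring.
  rewrite big_mkcond; apply: eq_bigr => j _; case: ifP => Ej; last first.
    by rewrite big1 // => e _; rewrite /=; ring.
  rewrite (Rsum_one (i := read_delay k j)); last by move=> e /negPf -> /=; ring.
  rewrite eqxx /= read_delayE //.
  have -> : (Z.of_nat k - (Z.of_nat k - tv (Z.of_nat k) (ik k) j) =
             tv (Z.of_nat k) (ik k) j)%Z by lia.
  by ring.
rewrite (Rsum_one (i := avg_src ik k t)); last by move=> s /negPf ->; ring.
rewrite eqxx Rmult_1_l /avg_state.
set K1 := Z.of_nat k.+1; have eK : K1 = (Z.of_nat k + 1)%Z by [lia]; move: eK; move: K1 => K1 eK.
case: t nt => [i|[i [[|e] he]]] nt /=.
- have ni : i <> ik k by move=> e; rewrite e eqxx in nt.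
  by rewrite x_idle // (negPf nt) Rplus_0_r.
- rewrite Z.sub_0_r eK; case: eqP => [ei|ni].
    by rewrite ei eqxx v_active /vsub /vscale; ring.
  by rewrite v_idle //= Z.sub_0_r Rplus_0_r.
- rewrite Rplus_0_r (inordK (ltnW he)).
  suff -> : (K1 - Z.pos (Pos.of_succ_nat e) = Z.of_nat k - Z.of_nat e)%Z by [].
  by lia.
Qed.

(* What j has sent to i by time k - e, or what i has already read if that is more recent;
   at e = D + 1 only the part already read is left. *)
Definition sent k i j e : vec n :=
  rho (if (e <= D)%N then Z.max (Z.of_nat k - Z.of_nat e) (tv (Z.of_nat k - 1) i j)
       else tv (Z.of_nat k - 1) i j) i j.

Definition push_state k (s : push_node I D) : vec n :=
  match s with
  | inl i => z k i
  | inr (i, (j, e)) => if E j i then vsub (sent k i j e) (sent k i j e.+1) else @vzero n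
  end.

Definition grad_increment k : vec n :=
  vsub (grad (ik k) (x k.+1 (ik k))) (grad (ik k) (x k (ik k))).

(** On each edge the classes at least as old as the delay telescope to [rho] at the new read time
    minus [rho] at the old one, which is [rt]. *)
Lemma push_ready_sum k c :
  \big[Rplus/R0]_s (if push_ready E ik read_delay k s then
     push_state k s c + (if s == inl (ik k) then grad_increment k c else 0) else 0) = pushed k c.
Proof.
rewrite big_sumType /= Rsum_pair [X in X + _](Rsum_one (i := ik k)); last by move=> i /negPf ->.
rewrite !eqxx [X in _ + X](Rsum_one (i := ik k)); last first.
  by move=> i /negPf ni; rewrite big1 // => -[j e] _ /=; rewrite ni.
rewrite Rsum_pair /pushed /vadd -/(grad_increment k) /vsum.
set S1 := (X in _ + X = _); set S2 := (X in _ = _ + X + _).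
suff -> : S1 = S2 by ring.
rewrite /S1 /S2 [RHS]big_mkcond; apply: eq_bigr => j _; rewrite eqxx /=.
case: ifP => Ej /=; last by rewrite big1 // => e _; rewrite /vzero /=; ring.
under eq_bigr => e _ do rewrite Rplus_0_r /vsub.
rewrite (Rsum_telescope_from (fun e => sent k (ik k) j e c)).
rewrite ltnW // /vsub rt_rho /sent ltnn -ltnS ltn_ord read_delayE //.
congr (rho _ _ _ _ - _); have := tv_mono k (ik k) j; lia.
Qed.

(* [sent] at time k with the read position already advanced by step k; ageing by one step
   turns it into [sent] at time k + 1. *)
Let kept k i j e : vec n :=
  rho (if (e <= D)%N then Z.max (Z.of_nat k - Z.of_nat e) (tv (Z.of_nat k) i j)
       else tv (Z.of_nat k) i j) i j.

(** Advancing the read position makes both ends of every ready class coincide and leaves the other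
    classes unchanged. *)
Lemma push_unread k i j (e : 'I_D.+1) c : E j i ->
  (if push_ready E ik read_delay k (inr (i, (j, e))) then 0
   else push_state k (inr (i, (j, e))) c) = kept k i j e c - kept k i j e.+1 c.
Proof.
move=> Ej; rewrite /= Ej /=; have eD := ltn_ord e; rewrite ltnS in eD.
have tm := tv_mono k i j.
have [ei|ni] := eqVneq i (ik k) => /=.
  have := @read_delayE k j; rewrite -ei => /(_ Ej) rd.
  have rD := ltn_ord (read_delay k j); rewrite ltnS in rD.
  case: (leqP (read_delay k j) e) => h.
    rewrite /kept eD.
    suff -> : (if (e < D)%N then Z.max (Z.of_nat k - Z.of_nat e.+1) (tv (Z.of_nat k) i j)
       else tv (Z.of_nat k) i j) = Z.max (Z.of_nat k - Z.of_nat e) (tv (Z.of_nat k) i j) by ring.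
    by case: ifP; lia.
  have eD' : (e < D)%N by apply: leq_trans h rD.
  rewrite /vsub /sent /kept eD eD'.
  by congr (rho _ _ _ _ - rho _ _ _ _); lia.
rewrite /vsub /sent /kept tv_idle // => -[e' _]; rewrite e' eqxx in ni; exact: notF.
Qed.

Lemma push_residual k i j (e' : 'I_D.+1) c : E j i ->
  \big[Rplus/R0]_s (if push_ready E ik read_delay k s then 0
     else if inr (i, (j, e')) == push_move s then push_state k s c else 0) =
  kept k i j e'.-1 c - (if (e' < D)%N then kept k i j e' c else kept k i j D.+1 c).
Proof.
move=> Ej; rewrite big_sumType /= big1 ?Rplus_0_l; last by move=> a _; case: ifP.
rewrite Rsum_pair (Rsum_one (i := i)); last first.
  move=> i' ni; rewrite big1 // => -[j' e] _.
  have -> : (inr (i, (j, e')) == inr (i', (j', inord (minn e.+1 D))) :> push_node I D) = false.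
    by apply/eqP => -[e1 _ _]; rewrite e1 eqxx in ni.
  by case: ifP.
rewrite Rsum_pair (Rsum_one (i := j)); last first.
  move=> j' nj; rewrite big1 // => e _.
  have -> : (inr (i, (j, e')) == inr (i, (j', inord (minn e.+1 D))) :> push_node I D) = false.
    by apply/eqP => -[e1 _]; rewrite e1 eqxx in nj.
  by case: ifP.
pose F e := kept k i j e c.
(* The condition minn e.+1 D = e' is a difference of two thresholds: e at least e'.-1, minus e at
   least [e'] when e' < D. This covers the empty inflow at age 0 < D and the pooled inflow at age
   D. *)
transitivity (\big[Rplus/R0]_(e < D.+1) ((if (e'.-1 <= e)%N then F e - F e.+1 else 0) -
   (if (e' < D)%N then (if (e' <= e)%N then F e - F e.+1 else 0) else 0))).
  apply: eq_bigr => e _; have := push_unread k e c Ej; rewrite -!/(F _) => un.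
  have -> : (inr (i, (j, e')) == inr (i, (j, inord (minn e.+1 D))) :> push_node I D) =
            (e' == minn e.+1 D :> nat).
    apply/eqP/eqP => [[->]|h]; first by rewrite inordK // ltnS geq_minr.
    by congr (inr (_, (_, _))); apply: val_inj; rewrite /= inordK // ltnS geq_minr.
  have eD := ltn_ord e; have eD' := ltn_ord e'.
  have -> : (if push_ready E ik read_delay k (inr (i, (j, e))) then 0
     else if e' == minn e.+1 D :> nat then push_state k (inr (i, (j, e))) c else 0) =
     if e' == minn e.+1 D :> nat then F e - F e.+1 else 0.
    by rewrite -un; case: ifP; case: ifP.
  case: eqP => h1; case: (leqP e'.-1 e) => h2; case: (ltnP e' D) => h3;
    case: (leqP e' e) => h4; try (exfalso; lia); ring.
rewrite Rsum_sub (Rsum_telescope_from F).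
have eD' := ltn_ord e'.
have -> : (e'.-1 <= D.+1)%N by lia.
case: ifP => h; last by rewrite big1 // /F; ring.
by rewrite (Rsum_telescope_from F) ltnW // /F; ring.
Qed.

Lemma push_driven : driven (push_weight E ik read_delay A) (fun k => inl (ik k))
  grad_increment push_state.
Proof.
move=> k t c; rewrite /push_weight.
(* Ready nodes share the same outgoing weights, so only their total [pushed k] matters; the rest
   merely ages. *)
transitivity (push_spread ik A k t * pushed k c +
  \big[Rplus/R0]_s (if push_ready E ik read_delay k s then 0
     else if t == push_move s then push_state k s c else 0)); last first.
  rewrite -push_ready_sum Rsum_mull -Rsum_add; apply: eq_bigr => s _.
  case: (boolP (push_ready _ _ _ _ _)) => [_|nr]; first by ring.
  have -> : (s == inl (ik k)) = false.
    by apply/eqP => es; move: nr; rewrite es /= eqxx.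
  by case: ifP => _; ring.
case: t => [i|[i [j e]]].
  rewrite big_sumType /= [X in _ + (_ + X)]big1; last by move=> [i' [j e]] _; case: ifP.
  rewrite [X in _ + (X + _)](Rsum_one (i := i)); last first.
    move=> i' ni; case: ifP => // _; case: eqP => // -[ei]; by rewrite ei eqxx in ni.
  rewrite eqxx; case: eqP => [->|ni]; first by rewrite z_active /vscale; ring.
  by rewrite z_idle //; ring.
case: (boolP (E j i)) => Ej; last first.
  have [_ [_ A0]] := HA.
  rewrite /= (negPf Ej) big1; last first.
    move=> s _; case: ifP => // _; case: eqP => // es.
    by case: s es => [//|[i' [j' e']]] [ei ej _]; rewrite /= -ei -ej (negPf Ej).
  case: ifP => [/and3P [/eqP ej _ ni]|_]; last by rewrite /vzero; ring.
  by rewrite A0 // ?ej // /vzero; ring.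
rewrite push_residual //= Ej.
have nij : i != j by apply/eqP => ij; move: Ej; rewrite ij (negPf (proj2 HE _)).
have step : rho (Z.of_nat k + 1) i j c =
    rho (Z.of_nat k) i j c + (if j == ik k then A i j * pushed k c else 0).
  case: eqP => [ej|nj]; last by rewrite rho_idle // Rplus_0_r.
  by move: Ej; rewrite ej => /rho_active ->.
have tm := tv_mono k i j.
have eK : (Z.of_nat k.+1 - 1 = Z.of_nat k)%Z by lia.
have sk e1 : (e1 < D)%N -> sent k.+1 i j e1.+1 = kept k i j e1.
  move=> h; rewrite /sent /kept eK h (ltnW h).
  by congr (rho _ _ _); lia.
have sD : sent k.+1 i j D.+1 = kept k i j D.+1 by rewrite /sent /kept eK ltnn.
have s0 : sent k.+1 i j 0 c = rho (Z.of_nat k + 1) i j c.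
  by rewrite /sent eK leq0n; congr (rho _ _ _ _); lia.
have k0 : kept k i j 0 c = rho (Z.of_nat k) i j c.
  by rewrite /kept leq0n; congr (rho _ _ _ _); lia.
have eD := ltn_ord e; rewrite ltnS in eD.
have nik : j == ik k -> i != ik k by move=> /eqP <-.
rewrite /vsub; case: e eD => [[|e] he] /= eD.
  rewrite s0 step k0.
  have -> : (if (j == ik k) && (i != ik k) then A i j else 0) * pushed k c =
            if j == ik k then A i j * pushed k c else 0.
    by case: (boolP (j == ik k)) => [/nik ->|_] /=; ring.
  (* For D = 0 the age-zero class is also the pooled one. *)
  case: (ltnP 0 D) => D0; first by rewrite sk // k0; ring.
  have D00 : D = 0%N by lia.
  by have := sD; rewrite D00 => ->; ring.
rewrite andbF Rmult_0_l Rplus_0_l sk //; congr (_ - _).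
case: (ltnP e.+1 D) => h; first by rewrite sk.
by have -> : e.+2 = D.+1 by [lia]; rewrite sD.
Qed.

(** The gradient-tracking invariant: nothing is in transit initially, and each step adds exactly the
    gradient change of the only agent that moves. *)
Lemma push_mass k : col_stochastic A -> mass push_state k = gradsum grad (x k).
Proof.
move=> A1; elim: k => [|k IH].
  apply: functional_extensionality => c; rewrite /mass big_sumType /=.
  have [h0 [_ [h1 [h2 _]]]] := Hs.
  rewrite [X in _ + X]big1 ?Rplus_0_r; first by apply: eq_bigr => i _; rewrite h0.
  move=> [i [j e]] _; case: ifP => // _; have eD := ltn_ord e.
  rewrite /vsub /sent /= h1 !h2 /vzero; first by ring.
  - by case: ifP; lia.
  - by case: ifP; lia.
rewrite (mass_step (push_weight_row ik read_delay (conj A1 HA)) push_driven) IH.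
apply: functional_extensionality => c; rewrite /vadd /gradsum.
rewrite (bigD1 (ik k)) //= [in RHS](bigD1 (ik k)) //= /grad_increment /vsub.
rewrite [in RHS](eq_bigr (fun i => grad i (x k i) c)); first by ring.
by move=> i /eqP ni; rewrite x_idle.
Qed.

End Trajectory.

(** * Error recursions *)

Section ErrorRecursions.
Variables (n I : nat) (E : rel 'I_I) (W A : 'I_I -> 'I_I -> R) (mbar : R) (T D : nat).
Variables (f : 'I_I -> vec n -> R) (grad : 'I_I -> vec n -> vec n) (L : 'I_I -> R).
Variables (tau : R) (xstar : vec n).
Hypotheses (HG : strongly_connected_noloop E) (Hm : 0 < mbar < 1).
Hypothesis HW : row_stochastic W /\ weight_pattern E W mbar.
Hypothesis HA : col_stochastic A /\ weight_pattern E A mbar.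
Hypothesis Hgrad : forall i, has_gradient (f i) (grad i).
Hypothesis HL : forall i, lipschitz (grad i) (L i).
Hypothesis Hsc : strongly_convex (sumf f) tau.
Hypothesis Hmin : forall y, sumf f xstar <= sumf f y.
Variables (gamma : R) (ik : nat -> 'I_I) (d : nat -> 'I_I -> nat)
  (x z : nat -> 'I_I -> vec n) (v : Z -> 'I_I -> vec n) (rho : Z -> 'I_I -> 'I_I -> vec n)
  (rt : nat -> 'I_I -> 'I_I -> vec n) (tv : Z -> 'I_I -> 'I_I -> Z).
Hypothesis Had : admissible_asynchrony E T D ik d.
Hypothesis Hs : asy_sonata E W A grad (fun _ => gamma) D ik d x z v rho rt tv.
Hypothesis gamma0 : 0 < gamma.

Let K := ((2 * I - 1) * T + I * D)%N.
Let eta := mbar ^ K.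
Let Ls := \big[Rplus/R0]_i Rabs (L i) + 1.
Let QW := avg_weight E ik (read_delay D ik tv) W.
Let QA := push_weight E ik (read_delay D ik tv) A.
Let H := avg_state (D := D) x v.
Let P := push_state E (D := D) z rho tv.
Let dW : driven QW _ _ H := avg_driven Had Hs.
Let dA : driven QA _ _ P := push_driven HG (proj2 HA) Had Hs.
Let QW0 : forall k s t, 0 <= QW k s t := avg_weight_ge0 ik (read_delay D ik tv) Hm HW.
Let QA0 : forall k s t, 0 <= QA k s t := push_weight_ge0 ik (read_delay D ik tv) Hm HA.
Let QW1 : forall k t, \big[Rplus/R0]_s QW k s t = 1 :=
  avg_weight_col ik (read_delay D ik tv) HG HW.
Let QA1 : forall k s, \big[Rplus/R0]_t QA k s t = 1 :=
  push_weight_row ik (read_delay D ik tv) HA.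

(** The centre is left free because each contraction moves it; delayed copies are included. *)
Definition consensus_error k X := exists c, forall s, vnorm (vsub (H k s) c) <= X.

(** Any reference agent would do for the push-sum weights; [ik 0] is one at hand. *)
Definition tracking_error k : R :=
  \big[Rplus/R0]_s vnorm (deviation QA P (inl (ik 0)) k s).

(* Distance to the minimizer of the weighted average x_psi^k, for every horizon m that is
   long enough for the weights to be bounded below. *)
Definition optimality_error k Z := forall m, (K <= m)%N ->
  vnorm (vsub (forecast QW H k m (inl (ik 0))) xstar) <= Z.

Let G y := gradsum grad (fun _ => y).

Lemma Ls_ge1 : 1 <= Ls.
Proof.
have : 0 <= \big[Rplus/R0]_i Rabs (L i) by apply: Rsum_ge0 => j _; apply: Rabs_pos.
by rewrite /Ls; lra.
Qed.

Lemma window_gt0 : (0 < K)%N.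
Proof.
have I0 := leq_ltn_trans (leq0n _) (ltn_ord (ik 0)).
have [t [h1 [h2 _]]] := proj1 Had 0%N (ik 0).
by rewrite /K; nia.
Qed.

Lemma eta_bounds : 0 < eta <= 1.
Proof.
split; first by apply: pow_lt; lra.
by rewrite -(pow1 K); apply: pow_incr; lra.
Qed.

Lemma transfer_avg_lb k i t : eta <= transfer QW k K (inl i) t.
Proof.
have := avg_reach (read_delay D ik tv) HG Hm (proj1 Had) HW k i t.
by move/(reach_transfer QW0 (Rlt_le _ _ (proj1 Hm))); rewrite addKn.
Qed.

Lemma transfer_push_lb k s i : eta <= transfer QA k K s (inl i).
Proof.
have := push_reach (read_delay D ik tv) HG Hm (proj1 Had) HA k s i.
by move/(reach_transfer QA0 (Rlt_le _ _ (proj1 Hm))); rewrite addKn.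
Qed.

Lemma gradsum_bound (y : 'I_I -> vec n) w X : 0 <= X ->
  (forall i, vnorm (vsub (y i) w) <= X) ->
  vnorm (vsub (gradsum grad y) (gradsum grad (fun _ => w))) <= Ls * X.
Proof.
move=> X0 hX; have := gradsum_lipschitz HL hX; rewrite /Ls; nra.
Qed.

Lemma gradient_bound y : vnorm (G y) <= Ls * vnorm (vsub y xstar).
Proof.
have := @gradsum_bound (fun _ => y) xstar _ (vnorm_ge0 _) (fun _ => Rle_refl _).
have e : G xstar = @vzero n := gradient_minimizer (has_gradient_sumf Hgrad) Hmin.
rewrite -/(G y) -/(G xstar) e.
suff -> : vsub (G y) (@vzero n) = G y by [].
by apply: functional_extensionality => c; rewrite /vsub /vzero; ring.
Qed.

Lemma forecast_near k m r c X : (forall s, vnorm (vsub (H k s) c) <= X) ->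
  vnorm (vsub (forecast QW H k m r) c) <= X.
Proof.
move=> hX; apply: vnorm_vcomb_sub_le => //; first by move=> s; apply: transfer_ge0.
exact: transfer_col1.
Qed.

Lemma consensus_forecast k m r X i : consensus_error k X ->
  vnorm (vsub (x k i) (forecast QW H k m r)) <= 2 * X.
Proof.
move=> [c hX]; have h1 : vnorm (vsub (x k i) c) <= X := hX (inl i).
have h2 := forecast_near m r hX.
by have := vnorm_sub_triangle c (x k i) (forecast QW H k m r); rewrite (vnorm_sub_sym c); lra.
Qed.

Lemma consensus_step k X Z : 0 <= X -> consensus_error k X ->
  (forall l, (l < K)%N -> vnorm (z (k + l)%N (ik (k + l)%N)) <= Z) ->
  consensus_error (k + K)%N ((1 - eta) * X + INR K * (gamma * Z)).
Proof.
move=> X0 [c hX] hZ.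
have [y hy] := radius_contraction QW0 QW1 dW (transfer_avg_lb k (ik 0)) X0 hX.
exists y => t; apply: Rle_trans (hy t) _; apply: Rplus_le_compat_l.
apply: (Rsum_ord_le (F := fun l => vnorm (vscale (- gamma) (z (k + l)%N (ik (k + l)%N))))) => l lK.
rewrite vnorm_scale Rabs_Ropp Rabs_pos_eq; last lra.
by apply: Rmult_le_compat_l; [lra | apply: hZ].
Qed.

Lemma tracking_step k V :
  (forall l, (l < K)%N -> vnorm (grad_increment grad ik x (k + l)%N) <= V) ->
  tracking_error (k + K)%N <= (1 - eta) * tracking_error k +
    (INR #|push_node I D| + 1) * (2 * (INR K * V)).
Proof.
move=> hV; have := deviation_contraction QA0 QA1 dA (inl (ik 0))
  (fun s => transfer_push_lb k s (ik 0)).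
move/Rle_trans; apply; apply: Rplus_le_compat_l.
have V0 : 0 <= V by apply: Rle_trans (hV 0%N window_gt0); apply: vnorm_ge0.
have N0 := pos_INR #|push_node I D|; have K0 := pos_INR K.
have hS : \big[Rplus/R0]_(l < K) vnorm (grad_increment grad ik x (k + l)) <= INR K * V.
  exact: (Rsum_ord_le (F := fun l => vnorm (grad_increment grad ik x (k + l)%N))).
have : 0 <= INR K * V by apply: Rmult_le_pos.
nra.
Qed.

(** The new x_i is within gamma [vnorm (z k i)] of an average of the states at time k, and that
    average and the old x_i both lie within X of the centre. *)
Lemma increment_bound k X : consensus_error k X ->
  vnorm (grad_increment grad ik x k) <= Ls * (2 * X + gamma * vnorm (z k (ik k))).
Proof.
move=> [c hX]; set i := ik k.
have h1 : vnorm (vsub (x k i) c) <= X := hX (inl i).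
have h2 := forecast_near 1 (inl i) hX.
have h3 : vnorm (vsub (x k.+1 i) (forecast QW H k 1 (inl i))) <= gamma * vnorm (z k i).
  have := forecast_error QW0 dW (transfer_col_le1 QW0 QW1) k 1 (inl i).
  by rewrite big_ord1 addn0 addn1 vnorm_scale Rabs_Ropp Rabs_pos_eq //; lra.
have h4 := vnorm_sub_triangle (forecast QW H k 1 (inl i)) (x k.+1 i) c.
have h5 := vnorm_sub_triangle c (x k.+1 i) (x k i).
rewrite (vnorm_sub_sym c) in h5.
have h6 : vnorm (vsub (x k.+1 i) (x k i)) <= 2 * X + gamma * vnorm (z k i) by lra.
apply: Rle_trans (HL i (x k.+1 i) (x k i)) _.
have LL : L i <= Ls.
  have := Rsum_mem_le (F := fun i => Rabs (L i)) i (fun j => Rabs_pos _).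
  by have := Rle_abs (L i); rewrite /Ls; lra.
apply: (Rle_trans _ (Ls * vnorm (vsub (x k.+1 i) (x k i)))).
  by apply: Rmult_le_compat_r => //; apply: vnorm_ge0.
by apply: Rmult_le_compat_l => //; have := Ls_ge1; lra.
Qed.

(** The total mass is the total gradient, so z is the deviation plus a push-sum weight times that
    gradient; after a full window the weight is at least [eta]. *)
Lemma direction_split k : exists xi dev, [/\ z k (ik k) = vadd dev (vscale xi (gradsum grad (x k))),
  vnorm dev <= tracking_error k, 0 <= xi <= 1 & (K <= k)%N -> eta <= xi].
Proof.
pose a : push_node I D := inl (ik k).
exists (transfer QA 0 k (inl (ik 0)) a), (deviation QA P (inl (ik 0)) k a); split.
- apply: functional_extensionality => c; rewrite /deviation /vadd /vsub /vscale.
  by rewrite /P (push_mass HG (proj2 HA) Had Hs k (proj1 HA)) /=; ring.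
- apply: (Rsum_mem_le (F := fun s => vnorm (deviation QA P (inl (ik 0)) k s))) => s.
  by apply: vnorm_ge0.
- by split; [apply: transfer_ge0 | apply: transfer_row_le1].
- by apply: (transfer_row_lb QA0 QA1) => k' s; apply: transfer_push_lb.
Qed.

Lemma consensus_ge0 k X : consensus_error k X -> 0 <= X.
Proof. by move=> [c hX]; apply: Rle_trans (hX (inl (ik 0))); apply: vnorm_ge0. Qed.

(** The total gradient is compared with [G] at the forecast point, and that with [G] at the
    minimizer, which is zero. *)
Lemma direction_bound k X Z : consensus_error k X -> optimality_error k Z ->
  vnorm (z k (ik k)) <= tracking_error k + Ls * (2 * X + Z).
Proof.
move=> hX hZ; have X0 := consensus_ge0 hX.
have [xi [dev [-> hdev xib _]]] := direction_split k.
pose y := forecast QW H k K (inl (ik 0)).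
have h1 : vnorm (vsub (gradsum grad (x k)) (G y)) <= Ls * (2 * X).
  by apply: gradsum_bound; [lra | move=> i; apply: consensus_forecast].
have h2 := gradient_bound y; have h3 : vnorm (vsub y xstar) <= Z by apply: hZ.
have h4 := Rmult_le_compat_l Ls _ _ ltac:(have := Ls_ge1; lra) h3.
have h5 : vnorm (gradsum grad (x k)) <= Ls * (2 * X) + Ls * Z.
  have -> : gradsum grad (x k) = vadd (vsub (gradsum grad (x k)) (G y)) (G y).
    by apply: functional_extensionality => c; rewrite /vadd /vsub; ring.
  have := vnorm_add (vsub (gradsum grad (x k)) (G y)) (G y); lra.
have := vnorm_add dev (vscale xi (gradsum grad (x k))).
rewrite vnorm_scale_ge0; last lra.
have := vnorm_ge0 (gradsum grad (x k)); nra.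
Qed.

(** Horizon m at k + 1 is horizon m + 1 at k, so quantifying over all long horizons closes the
    recursion. The forecast moves by -gamma psi z, a gradient step up to the tracking and consensus
    errors. *)
Lemma optimality_step k X Z : (K <= k)%N -> gamma * tau <= 1 -> gamma * Ls ^ 2 <= tau / 2 ->
  consensus_error k X -> 0 <= Z -> optimality_error k Z ->
  optimality_error k.+1
    ((1 - 3 / 4 * gamma * eta ^ 2 * tau) * Z + gamma * (tracking_error k + 2 * Ls * X)).
Proof.
move=> Kk gt gL hX Z0 hZ m Km; have X0 := consensus_ge0 hX.
have [tau0 _] := Hsc; have [eta0 eta1] := eta_bounds.
rewrite (forecast_step dW).
set psi := transfer _ _ _ _ _; set y := forecast _ _ _ _ _.
have psi_lb : eta <= psi.
  by apply: (transfer_col_lb QW0 QW1) (leqW Km) => k' t; apply: transfer_avg_lb.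
have psi_ub : psi <= 1 by apply: transfer_col_le1.
have [xi [dev [-> hdev [_ xi_ub] /(_ Kk) xi_lb]]] := direction_split k.
have hy : vnorm (vsub y xstar) <= Z by apply: hZ; apply: leqW.
have hg : vnorm (vsub (gradsum grad (x k)) (G y)) <= Ls * (2 * X).
  by apply: gradsum_bound; [lra | move=> i; apply: consensus_forecast].
(* The effective step length, between gamma eta^2 and gamma. *)
pose r := gamma * (psi * xi).
have pxi : eta ^ 2 <= psi * xi <= 1 by nra.
have r_lb : gamma * eta ^ 2 <= r by apply: Rmult_le_compat_l; lra.
have r_ub : r <= gamma by rewrite /r; nra.
have r0 : 0 <= r by apply: Rle_trans r_lb; apply: Rmult_le_pos; nra.
have Ls2 : 0 <= Ls ^ 2 by nra.
have c1 := gradient_step_contraction (has_gradient_sumf Hgrad) Hsc Hmin (gradient_bound y) r0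
  ltac:(nra) ltac:(nra).
set w := vadd _ _.
have -> : vsub w xstar = vsub (vsub (vsub y (vscale r (G y))) xstar)
    (vscale (gamma * psi) (vadd dev (vscale xi (vsub (gradsum grad (x k)) (G y))))).
  by apply: functional_extensionality => c; rewrite /w /r /vadd /vsub /vscale; ring.
apply: Rle_trans (vnorm_sub _ _) _; apply: Rplus_le_compat.
  apply: Rle_trans c1 _.
  have rt' : gamma * eta ^ 2 * tau <= r * tau by apply: Rmult_le_compat_r; lra.
  have : gamma * eta ^ 2 * tau <= 1 by apply: Rle_trans rt' _; nra.
  have := vnorm_ge0 (vsub y xstar); nra.
rewrite vnorm_scale_ge0; last by nra.
rewrite Rmult_assoc; apply: Rmult_le_compat_l; first lra.
set q := vadd _ _.
have hq : vnorm q <= tracking_error k + 2 * Ls * X.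
  apply: Rle_trans (vnorm_add _ _) _; rewrite vnorm_scale_ge0; last lra.
  have := vnorm_ge0 (vsub (gradsum grad (x k)) (G y)); nra.
have := vnorm_ge0 q; nra.
Qed.

(** Finitely many steps have finitely many errors. The bound depends on the trajectory and affects
    only the final constant, not the step size. *)
Lemma initial_bound N : exists M, 0 < M /\ forall k, (k < N)%N ->
  [/\ consensus_error k M, tracking_error k <= M & optimality_error k M].
Proof.
pose B k := \big[Rplus/R0]_s vnorm (vsub (H k s) xstar).
have B0 k : 0 <= B k by apply: Rsum_ge0 => s _; apply: vnorm_ge0.
have t0 k : 0 <= tracking_error k by apply: Rsum_ge0 => s _; apply: vnorm_ge0.
exists (1 + \big[Rplus/R0]_(k < N) (B k + tracking_error k)); split.
  have : 0 <= \big[Rplus/R0]_(k < N) (B k + tracking_error k).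
    by apply: Rsum_ge0 => k _; have := B0 k; have := t0 k; lra.
  by lra.
move=> k kN; have := @Rsum_mem_le _ (fun k : 'I_N => B k + tracking_error k) (Ordinal kN)
  (fun k => Rplus_le_le_0_compat _ _ (B0 k) (t0 k)).
rewrite /=; set M := \big[Rplus/R0]_(_ < N) _ => hM.
have hB s : vnorm (vsub (H k s) xstar) <= 1 + M.
  have := @Rsum_mem_le _ (fun s => vnorm (vsub (H k s) xstar)) s (fun s => vnorm_ge0 _).
  by rewrite -/(B k); have := t0 k; lra.
split; first by exists xstar.
- by have := B0 k; lra.
- by move=> m _; apply: forecast_near.
Qed.

Lemma stacked_err_bound k X Z : consensus_error k X -> optimality_error k Z ->
  stacked_err (x k) xstar <= INR I * (2 * X + Z).
Proof.
move=> hX hZ; have X0 := consensus_ge0 hX.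
have hi i : vnorm (vsub (x k i) xstar) <= 2 * X + Z.
  have := consensus_forecast K (inl (ik 0)) i hX; have := hZ K (leqnn _).
  have := vnorm_sub_triangle (forecast QW H k K (inl (ik 0))) (x k i) xstar; lra.
have q0 : 0 <= 2 * X + Z by apply: Rle_trans (hi (ik 0)); apply: vnorm_ge0.
have I1 : 1 <= INR I by apply: (le_INR 1); apply/leP; apply: leq_ltn_trans (ltn_ord (ik 0)).
have Iq : 0 <= INR I * (2 * X + Z) by apply: Rmult_le_pos; lra.
rewrite /stacked_err -[X in _ <= X](sqrt_pow2 _ Iq); apply: sqrt_le_1_alt.
(* With q = 2X + Z, the I squares sum to at most I q^2, which is below (I q)^2 as I >= 1. *)
apply: (Rle_trans _ (\big[Rplus/R0]_(i < I) ((2 * X + Z) ^ 2))).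
  by apply: Rsum_le => i _; rewrite -vnorm_sqr; apply: pow_incr; split; [apply: vnorm_ge0|].
rewrite Rsum_const card_ord Rpow_mult_distr; apply: Rmult_le_compat_r; nra.
Qed.

End ErrorRecursions.

(** * Choice of the step size and conclusion *)

Lemma linear_rate
  (n I : nat) (E : rel 'I_I) (W A : 'I_I -> 'I_I -> R) (mbar : R) (T D : nat)
  (f : 'I_I -> vec n -> R) (grad : 'I_I -> vec n -> vec n) (L : 'I_I -> R)
  (tau : R) (xstar : vec n) :
  strongly_connected_noloop E -> 0 < mbar < 1 ->
  row_stochastic W /\ weight_pattern E W mbar ->
  col_stochastic A /\ weight_pattern E A mbar ->
  (forall i, has_gradient (f i) (grad i)) -> (forall i, lipschitz (grad i) (L i)) ->
  strongly_convex (sumf f) tau -> (forall y, sumf f xstar <= sumf f y) ->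
  let eta := mbar ^ ((2 * I - 1) * T + I * D)%nat in
  exists g0, 0 < g0 /\ g0 * tau * eta ^ 2 < 2 /\
  forall gamma, 0 < gamma <= g0 ->
  forall ik d x z v rho rt tv,
    admissible_asynchrony E T D ik d ->
    asy_sonata E W A grad (fun _ => gamma) D ik d x z v rho rt tv ->
    exists C, forall k : nat,
      stacked_err (x k) xstar <= C * (1 - tau * eta ^ 2 * gamma / 2) ^ k.
Proof.
move=> HG Hm HW HA Hgrad HL Hsc Hmin eta; have [tau0 _] := Hsc.
set K := ((2 * I - 1) * T + I * D)%N in eta *.
have eta0 : 0 < eta <= 1 := eta_bounds I T D Hm.
have e2 : 0 < tau * eta ^ 2 by apply: Rmult_lt_0_compat => //; apply: pow_lt; lra.
(* An empty window excludes any admissible schedule, so here g0 only has to meet its numerical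
   bound. *)
have [K0|K0] := posnP K.
  exists (/ (tau * eta ^ 2)); split; first exact: Rinv_0_lt_compat.
  split; first by rewrite Rmult_assoc Rinv_l; lra.
  move=> gamma hg ik d x z v rho rt tv Had _.
  by have := window_gt0 Had; rewrite -/K K0.
pose Ls := \big[Rplus/R0]_i Rabs (L i) + 1.
have Ls1 : 1 <= Ls := Ls_ge1 L.
have Sz1 : 1 <= INR #|push_node I D| + 1 by have := pos_INR #|push_node I D|; lra.
have [g1 [g10 [g1b h1]]] := three_scale_decay K0 eta0 tau0 Ls1 Sz1.
(* [g2] and [g3] provide the two step-size conditions of [optimality_step]. *)
have [g2 [g20 h2]] := small_factor (c := tau) (e := 1) ltac:(lra) ltac:(lra).
have [g3 [g30 h3]] := small_factor (c := Ls ^ 2) (e := tau / 2) ltac:(nra) ltac:(lra).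
pose g0 := Rmin g1 (Rmin g2 g3).
have le1 : g0 <= g1 by apply: Rmin_l.
have le2 : g0 <= g2 by apply: Rle_trans (Rmin_r _ _) (Rmin_l _ _).
have le3 : g0 <= g3 by apply: Rle_trans (Rmin_r _ _) (Rmin_r _ _).
have g00 : 0 < g0 by do 2!(apply: Rmin_glb_lt => //).
exists g0; split=> //; split.
  by rewrite Rmult_assoc; rewrite Rmult_assoc in g1b; nra.
move=> gamma [gamma0 hg] ik d x z v rho rt tv Had Hs.
have gt := h2 gamma ltac:(lra); have gL := h3 gamma ltac:(lra).
have [||||||||B hB] := h1 gamma (conj gamma0 (Rle_trans _ _ _ hg le1))
  (consensus_error D x v) (tracking_error E A D ik z rho tv)
  (optimality_error E W T D xstar ik x v tv)
  (fun k => vnorm (z k (ik k))) (fun k => vnorm (grad_increment grad ik x k)).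
- by move=> k X X' hXX [c hc]; exists c => s; apply: Rle_trans (hc s) hXX.
- by move=> k X X' hXX hX m hm; apply: Rle_trans (hX m hm) hXX.
- exact: (initial_bound A T D xstar HG Hm HW).
- exact: (consensus_step HG Hm HW Had Hs gamma0).
- exact: (tracking_step HG Hm HA Had Hs).
- move=> k X Z Kk _ Z0 hX hZ.
  exact: (optimality_step HG Hm HW HA Hgrad HL Hsc Hmin Had Hs gamma0 Kk gt gL hX Z0 hZ).
- move=> k X Z _; exact: (direction_bound HG Hm HW HA Hgrad HL Hmin Had Hs).
- exact: (increment_bound HG Hm HW HL Had Hs gamma0).
exists (INR I * (3 * B)) => k; have [c o] := hB k.
have := stacked_err_bound HG Hm HW c o.
by move/Rle_trans; apply; apply: Req_le; ring.
Qed.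

Theorem theorem2
  (n I : nat) (E : rel 'I_I) (W A : 'I_I -> 'I_I -> R) (mbar : R) (T D : nat)
  (f : 'I_I -> vec n -> R) (grad : 'I_I -> vec n -> vec n) (L : 'I_I -> R)
  (tau : R) (xstar : vec n)
  (HG : strongly_connected_noloop E)
  (Hm : 0 < mbar < 1)
  (HW : row_stochastic W /\ weight_pattern E W mbar)
  (HA : col_stochastic A /\ weight_pattern E A mbar)
  (Hgrad : forall i, has_gradient (f i) (grad i))
  (HL : forall i, lipschitz (grad i) (L i))
  (Hsc : strongly_convex (sumf f) tau)
  (Hmin : forall y, sumf f xstar <= sumf f y) :
  exists gbar1, 0 < gbar1 /\
    (forall gamma, 0 < gamma < gbar1 ->
       exists lam, 0 < lam < 1 /\
         forall ik d x z v rho rt tv,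
           admissible_asynchrony E T D ik d ->
           asy_sonata E W A grad (fun _ => gamma) D ik d x z v rho rt tv ->
           exists C, forall k : nat, stacked_err (x k) xstar <= C * lam ^ k) /\
    (exists ghat1, 0 < ghat1 < gbar1 /\
       forall gamma, 0 < gamma <= ghat1 ->
         let eta := mbar ^ ((2 * I - 1) * T + I * D)%nat in
         forall ik d x z v rho rt tv,
           admissible_asynchrony E T D ik d ->
           asy_sonata E W A grad (fun _ => gamma) D ik d x z v rho rt tv ->
           exists C, forall k : nat,
             stacked_err (x k) xstar <= C * (1 - tau * eta ^ 2 * gamma / 2) ^ k).
Proof.
have [tau0 _] := Hsc.
have [g0 [g00 [g0b rate]]] :=
  linear_rate T D HG Hm HW HA Hgrad HL Hsc Hmin.
set eta := mbar ^ _ in g0b rate.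
have e2 : 0 < tau * eta ^ 2.
  by apply: Rmult_lt_0_compat => //; do 2!apply: pow_lt; lra.
(* The explicit rate serves both claims; [g0b] makes it positive, and halving [g0] gives a strictly
   smaller second threshold. *)
exists g0; split=> //; split.
  move=> gamma [gam0 hg]; exists (1 - tau * eta ^ 2 * gamma / 2); split; first by nra.
  by apply: rate; lra.
exists (g0 / 2); split; first lra.
by move=> gamma [gam0 hg]; apply: rate; lra.
Qed.
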